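(* For every nonzero semisimple $X\in\mathfrak g_1$, the $\theta$-connection $\nabla^X$ has an irregular singularity at $t=\infty$ with slope $e/m$, where $m$ is the order of $\theta\in\mathrm{Aut}(\mathfrak g)$ and $e$ is the order of the image $\sigma$ of $\theta$ in the group of outer automorphisms of $\mathfrak g$.
   Context: Group data. $G$ is a simple complex algebraic group of adjoint type, $T\subset B\subset G$ a maximal torus and a Borel subgroup, $\mathfrak g=\mathrm{Lie}\,G$, $\mathfrak t=\mathrm{Lie}\,T$, $R$ the set of roots of $T$ in $G$, $\Delta$ the set of simple roots, $\check{\mathbb X}$ the coweight (cocharacter) lattice of $T$, $V=\check{\mathbb X}\otimes\mathbb R$. A pinning is fixed; it gives $\mathrm{Aut}(\mathfrak g)=G\rtimes\mathrm{Aut}(R,\Delta)$, where $\mathrm{Aut}(R,\Delta)$ is the group of automorphisms of the root system preserving $\Delta$, acting by pinned automorphisms. $\exp:V\to T$ is defined by $\alpha(\exp(x))=e^{2\pi i\alpha(x)}$ for all weights $\alpha$ of $T$. Put $\xi_n=e^{2\pi i/n}$. A superscript $\sigma$ denotes $\sigma$-fixed vectors. Alcove. Let $\sigma\in\mathrm{Aut}(R,\Delta)$ have order $e$. For each $\sigma$-orbit $a$ on $R$ let $\beta_a$ be the restriction to $\mathfrak t^\sigma$ of any root in $a$; these form a (possibly non-reduced) root system $R^\sigma$ with basis $\{\beta_1,\dots,\beta_{\ell_\sigma}\}$ coming from the $\sigma$-orbits on $\Delta$. Let $\eta$ be the highest root if $\sigma=\mathrm{id}$; if $\sigma\ne \mathrm{id}$,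 the highest short root of $R^\sigma$, except in type ${}^2A_{2n}$, where $\eta$ is twice the highest short root of $R^\sigma$. Put $\beta_0=1/e-\eta$ (an affine function). The closed fundamental alcove is $\bar C^\sigma=\{x\in V^\sigma:\beta_i(x)\ge 0,\ i=0,\dots,\ell_\sigma\}$. The automorphism $\theta$. $\theta=\exp(x)\rtimes\sigma\in\mathrm{Aut}(\mathfrak g)$ has finite order $m$, with $x\in\bar C^\sigma$ (every torsion automorphism of $\mathfrak g$ is $G$-conjugate to one of this form). It defines the grading $\mathfrak g=\bigoplus_{i\in\mathbb Z/m\mathbb Z}\mathfrak g_i$, $\theta=\xi_m^i$ on $\mathfrak g_i$. Put $s_0=m\beta_0(x)$, an integer, and $\check\lambda=mx\in\check{\mathbb X}^\sigma$; $\mathfrak g(k)$ is the subspace on which $\mathrm{Ad}\,\check\lambda(z)$ acts by $z^k$, and $\mathfrak g_i(k)=\mathfrak g_i\cap\mathfrak g(k)$. The $\theta$-connection. For $X\in\mathfrak g_1$ write $X=\sum_k X_k$ with $X_k\in\mathfrak g_1(k)$; $X_k=0$ unless $-m+es_0\le k\le 1$ and $k\equiv 1 \bmod \frac me$. The $\theta$-connection is the flat $G$-connection on the trivial $G$-bundle on $\mathrm{Spec}\,\mathbb C[t,t^{-1}]$ $$\nabla^X=d+\sum_{k}X_k\,t^{e(1-k)/m}\,\frac{dt}{t}.$$ Slope. A connection on a principal $G$-bundle with irregular singularity at a point $p$ of a curve has slope $a/b>0$ at $p$ if the following holds: let $s$ be a uniformizing parameter at $p$ and pass to the extension obtained by adjoining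 $u$ with $u^b=s$; then the connection, written using the parameter $u$ and a suitable trivialization of the bundle on the punctured disc, has a pole of order $a+1$ at $p$, and its polar part (the leading coefficient) is not nilpotent. *)

(* Defs.v *)
From HB Require Import structures.
From mathcomp Require Import all_boot all_order all_algebra all_fingroup.
From mathcomp Require Import zify.
From mathcomp Require Import complex.
From mathcomp Require Import boolp classical_sets functions cardinality fsbigop.
From mathcomp Require Import reals trigo.
From mathcomp Require mpoly.
Set Implicit Arguments. Unset Strict Implicit. Unset Printing Implicit Defensive.
Import Order.TTheory GRing.Theory Num.Theory.
Local Open Scope classical_set_scope.
Local Open Scope ring_scope.

(* Formal Laurent series over F: functions on int with support
   bounded below, with the Cauchy product. *)
Section Laurent.
Variable F : comNzRingType.
Implicit Types f g h : int -> F.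

Definition lbounded f := exists n : nat, forall k : int, k < - n%:Z -> f k = 0.

Record laurent := Laurent { lcoef :> int -> F; lcoefP : lbounded lcoef }.

Lemma laurentP (a b : laurent) : lcoef a =1 lcoef b -> a = b.
Proof.
case: a b => f pf [g pg] /= /funext efg; rewrite efg in pf *.
by congr Laurent; exact: Prop_irrelevance.
Qed.

Definition lmulf f g (k : int) : F :=
  (\sum_(i \in [set: int]) (f i * g (k - i)))%R.

Lemma lconst_bounded c : lbounded (fun k => if k == 0 then c else 0).
Proof. by exists 0 => k hk; case: eqP => // k0; move: hk; rewrite k0; lia. Qed.

Lemma lmono_bounded (n : int) : lbounded (fun k => if k == n then 1 else 0).
Proof. by exists `|n|%N => k hk; case: eqP => // k0; move: hk; rewrite k0; lia. Qed.

Lemma lopp_bounded (a : laurent) : lbounded (fun k => - a k).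
Proof. by case: (lcoefP a) => n hn; exists n => k /hn->; rewrite oppr0. Qed.

Lemma ladd_bounded (a b : laurent) : lbounded (fun k => a k + b k).
Proof.
case: (lcoefP a) => n hn; case: (lcoefP b) => p hp.
by exists (n + p)%N => k hk; rewrite hn ?hp ?addr0 //; lia.
Qed.

(* Truncations, used to transport the ring axioms from {poly F}. *)
Definition ltrunc f (n M : nat) : {poly F} := \poly_(j < M) f (j%:Z - n%:Z).

Lemma lmulf_trunc f g (n p K M : nat) :
  (forall k, k < - n%:Z -> f k = 0) -> (forall k, k < - p%:Z -> g k = 0) ->
  (K < M)%N -> lmulf f g (K%:Z - (n + p)%:Z) = (ltrunc f n M * ltrunc g p M)`_K.
Proof.
move=> hf hg KM; rewrite coefM /lmulf.
pose r : seq int := [seq (j%:Z - n%:Z) | j <- iota 0 K.+1].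
have ur : uniq r by rewrite map_inj_uniq ?iota_uniq // => x y; lia.
rewrite (fsbigE r _ ur) //; last first.
  move=> i _ ir; case: (ltrP i (- n%:Z)) => [/hf-> | ni]; first by rewrite mul0r.
  rewrite hg ?mulr0 // ltNge; apply: contra ir => ?.
  by apply/mapP; exists (absz (i + n%:Z)%R); rewrite ?mem_iota; lia.
rewrite (eq_bigl xpredT); last by move=> i; rewrite in_setT.
rewrite big_map -(big_mkord xpredT
  (fun j => (ltrunc f n M)`_j * (ltrunc g p M)`_(K - j))) /index_iota subn0.
apply: eq_big_seq => j; rewrite mem_iota add0n => /andP[_ jK].
rewrite !coef_poly ifT; last by lia.
rewrite ifT; last by lia.
by congr (f _ * g _); lia.
Qed.

Lemma lmulf_small f g (n p : nat) k :
  (forall k, k < - n%:Z -> f k = 0) -> (forall k, k < - p%:Z -> g k = 0) ->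
  k < - (n + p)%N%:Z -> lmulf f g k = 0.
Proof.
move=> hf hg kK; apply: fsbig1 => i _.
case: (ltrP i (- n%:Z)) => [/hf-> | ni]; first by rewrite mul0r.
by rewrite hg ?mulr0 //; lia.
Qed.

Lemma lmul_bounded (a b : laurent) : lbounded (lmulf a b).
Proof.
case: (lcoefP a) => n hn; case: (lcoefP b) => p hp.
by exists (n + p)%N => k; exact: lmulf_small.
Qed.

Definition lconst c := Laurent (lconst_bounded c).
Definition lmono n := Laurent (lmono_bounded n).
Definition lopp a := Laurent (lopp_bounded a).
Definition ladd a b := Laurent (ladd_bounded a b).
Definition lmul a b := Laurent (lmul_bounded a b).

HB.instance Definition _ := gen_eqMixin laurent.
HB.instance Definition _ := gen_choiceMixin laurent.

Fact laddA : associative ladd.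
Proof. by move=> a b c; apply: laurentP => k /=; rewrite addrA. Qed.
Fact laddC : commutative ladd.
Proof. by move=> a b; apply: laurentP => k /=; rewrite addrC. Qed.
Fact ladd0 : left_id (lconst 0) ladd.
Proof. by move=> a; apply: laurentP => k /=; case: eqP; rewrite add0r. Qed.
Fact laddN : left_inverse (lconst 0) lopp ladd.
Proof. by move=> a; apply: laurentP => k /=; case: eqP; rewrite addNr. Qed.

HB.instance Definition _ := GRing.isZmodule.Build laurent laddA laddC ladd0 laddN.

Lemma lbound_widen f (n n' : nat) : (n <= n')%N ->
  (forall k, k < - n%:Z -> f k = 0) -> (forall k, k < - n'%:Z -> f k = 0).
Proof. by move=> nn hf k hk; apply: hf; lia. Qed.

Lemma ltrunc_mul (a b : laurent) (n p K M : nat) :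
  (forall k, k < - n%:Z -> a k = 0) -> (forall k, k < - p%:Z -> b k = 0) ->
  (K < M)%N -> (ltrunc (lmul a b) (n + p) M)`_K = (ltrunc a n M * ltrunc b p M)`_K.
Proof. by move=> hn hp KM; rewrite coef_poly KM; apply: lmulf_trunc. Qed.

Fact lmulA : associative lmul.
Proof.
move=> a b c; apply: laurentP => k /=.
case: (lcoefP a) => n hn; case: (lcoefP b) => p hp; case: (lcoefP c) => q hq.
have hab k' : k' < - (n + p)%N%:Z -> lmul a b k' = 0 by exact: lmulf_small.
have hbc k' : k' < - (p + q)%N%:Z -> lmul b c k' = 0 by exact: lmulf_small.
case: (ltrP k (- (n + (p + q))%N%:Z)) => hk.
  by rewrite (lmulf_small hn hbc) // (lmulf_small hab hq) //; lia.
pose K := absz (k + (n + (p + q))%N%:Z).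
have -> : k = K%:Z - (n + (p + q))%N%:Z by rewrite /K; lia.
rewrite (lmulf_trunc hn hbc (ltnSn K)) [in RHS]addnA (lmulf_trunc hab hq (ltnSn K)).
set P := ltrunc a n K.+1; set Q := ltrunc b p K.+1; set S := ltrunc c q K.+1.
transitivity ((P * (Q * S))`_K); [|rewrite mulrA]; rewrite coefM [in RHS]coefM.
  by apply: eq_bigr => i _; rewrite ltrunc_mul // ltnS leq_subr.
by apply: eq_bigr => i _; rewrite ltrunc_mul.
Qed.

Fact lmulC : commutative lmul.
Proof.
move=> a b; apply: laurentP => k /=.
case: (lcoefP a) => n hn; case: (lcoefP b) => p hp.
case: (ltrP k (- (n + p)%N%:Z)) => hk.
  by rewrite !(lmulf_small hn hp, lmulf_small hp hn) // addnC.
pose K := absz (k + (n + p)%N%:Z).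
have -> : k = K%:Z - (n + p)%N%:Z by rewrite /K; lia.
by rewrite (lmulf_trunc hn hp (ltnSn K)) addnC (lmulf_trunc hp hn (ltnSn K)) mulrC.
Qed.

Fact lmul1 : left_id (lconst 1) lmul.
Proof.
move=> a; apply: laurentP => k /=; rewrite /lmulf.
rewrite (fsbigE [:: 0]) //=; first by rewrite big_cons big_nil in_setT eqxx mul1r subr0 addr0.
by move=> i _; rewrite inE => /negPf->; rewrite mul0r.
Qed.

Fact lmulDl : left_distributive lmul ladd.
Proof.
move=> a b c; apply: laurentP => k /=.
case: (lcoefP a) => n hn; case: (lcoefP b) => p hp; case: (lcoefP c) => q hq.
have {}hn := lbound_widen (leq_addr p n) hn.
have {}hp := lbound_widen (leq_addl n p) hp.
set N := (n + p)%N in hn hp.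
have hab k' : k' < - N%:Z -> ladd a b k' = 0 by move=> h; rewrite /= hn ?hp ?addr0.
case: (ltrP k (- (N + q)%N%:Z)) => hk.
  by rewrite (lmulf_small hab hq) // (lmulf_small hn hq) // (lmulf_small hp hq) // addr0.
pose K := absz (k + (N + q)%N%:Z).
have -> : k = K%:Z - (N + q)%N%:Z by rewrite /K; lia.
rewrite (lmulf_trunc hab hq (ltnSn K)) (lmulf_trunc hn hq (ltnSn K)).
rewrite (lmulf_trunc hp hq (ltnSn K)) -coefD -mulrDl.
suff -> : ltrunc (ladd a b) N K.+1 = ltrunc a N K.+1 + ltrunc b N K.+1 by [].
by apply/polyP => i; rewrite coefD !coef_poly; case: ifP; rewrite ?addr0.
Qed.

Fact lone_neq0 : lconst 1 != 0.
Proof.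
by apply/eqP => /(congr1 (fun a : laurent => a 0)) /= /eqP; rewrite oner_eq0.
Qed.

HB.instance Definition _ :=
  GRing.Zmodule_isComNzRing.Build laurent
  lmulA lmulC lmul1 lmulDl lone_neq0.

(* Units and inverses are the ring-theoretic ones, chosen classically. *)
Definition lunit : {pred laurent} := fun a => `[< exists b : laurent, b * a = 1 >].
Definition linv (a : laurent) : laurent :=
  if pselect (exists b : laurent, b * a = 1) is left e then projT1 (cid e) else a.

Fact lmulV : {in lunit, left_inverse 1 linv *%R}.
Proof.
move=> a; rewrite unfold_in => /asboolP ea; rewrite /linv.
by case: pselect => // e; case: (cid e).
Qed.
Fact lunitP (a b : laurent) : b * a = 1 -> lunit a.
Proof. by move=> ba; apply/asboolP; exists b. Qed.
Fact linv_out : {in [predC lunit], linv =1 id}.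
Proof.
by move=> a; rewrite inE unfold_in => /asboolP na; rewrite /linv; case: pselect.
Qed.

HB.instance Definition _ :=
  GRing.ComNzRing_hasMulInverse.Build laurent lmulV lunitP linv_out.

Lemma lmonoD (n p : int) : lmono n * lmono p = lmono (n + p).
Proof.
apply: laurentP => k /=; rewrite /lmulf (fsbigE [:: n]) //=.
  by rewrite big_cons big_nil in_setT eqxx mul1r addr0; congr (if _ then _ else _); lia.
by move=> i _; rewrite inE => /negPf->; rewrite mul0r.
Qed.

Lemma lmonoV (n : int) : (lmono n)^-1 = lmono (- n).
Proof.
have e1 : lmono (- n) * lmono n = 1 by rewrite lmonoD addNr; exact: laurentP.
have un : lmono n \is a GRing.unit by apply/unitrPr; exists (lmono (- n)); rewrite mulrC.
by apply: (mulIr un); rewrite mulVr.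
Qed.

Lemma lderiv_bounded (a : laurent) : lbounded (fun k => a (k + 1) *~ (k + 1)).
Proof.
by case: (lcoefP a) => n hn; exists n.+1 => k hk; rewrite hn ?mul0rz //; lia.
Qed.
Definition lderiv a := Laurent (lderiv_bounded a).

Lemma lsubst_bounded (b : nat) (a : laurent) :
  lbounded (fun k => if (b.+1%:Z %| k)%Z then a (k %/ b.+1%:Z)%Z else 0).
Proof.
case: (lcoefP a) => n hn; exists (n * b.+1)%N => k hk.
case: ifP => // /dvdzP[q kE]; rewrite hn // kE mulzK //.
by rewrite kE in hk; rewrite -(ltr_pM2r (_ : 0 < b.+1%:Z)) //; lia.
Qed.
(* The substitution s = u ^ b, meant for 0 < b. *)
Definition lsubst b a := Laurent (lsubst_bounded b.-1 a).
End Laurent.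

Section AlgebraicGroups.
Variables (R : realType) (N : nat).
Notation C := R[i].
Implicit Types (A Y : 'M[C]_N) (G H T B : set 'M[C]_N).

(* Polynomial functions of the matrix entries. *)
Notation mxpolyfun := (mpoly.mpoly (N * N) C).

Definition pev (p : mxpolyfun) A : C := mpoly.meval (fun k => mxvec A 0 k) p.

(* The differential of p at the identity matrix, in the direction Y. *)
Definition pdiff (p : mxpolyfun) Y : C :=
  \sum_(i < N) \sum_(j < N)
     Y i j * pev (mpoly.mderiv (mxvec_index i j) p) 1%:M.

Definition vanishes_on H (p : mxpolyfun) := forall A, H A -> pev p A = 0.

(* Zariski closed subsets of GL_N. *)
Definition zclosed H := exists S : set mxpolyfun,
  H = [set A | A \in unitmx /\ forall p, S p -> pev p A = 0].

Definition zconnected H := forall Z1 Z2, zclosed Z1 -> zclosed Z2 ->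
  H `<=` Z1 `|` Z2 -> H `&` Z1 `&` Z2 = set0 -> H `<=` Z1 \/ H `<=` Z2.

Definition mxsubgroup H :=
  [/\ forall A, H A -> A \in unitmx, H 1%:M,
      forall A A', H A -> H A' -> H (A *m A') &
      forall A, H A -> H (invmx A)].

Definition alg_group H := mxsubgroup H /\ zclosed H.

Definition normal_in H G := forall A Y, G A -> H Y -> H (A *m Y *m invmx A).

Definition simple_group G :=
  [/\ alg_group G, zconnected G,
      exists A A', [/\ G A, G A' & A *m A' <> A' *m A] &
      forall H, alg_group H -> zconnected H -> H `<=` G -> normal_in H G ->
        H = [set 1%:M] \/ H = G].

(* A semisimple group is of adjoint type when its center is trivial. *)
Definition adjoint_type G :=
  forall A, G A -> (forall A', G A' -> A *m A' = A' *m A) -> A = 1%:M.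

(* Lie algebra = Zariski tangent space at the identity, inside gl_N. *)
Definition Lie H : set 'M[C]_N :=
  [set Y | forall p, vanishes_on H p -> pdiff p Y = 0].

Definition bracket Y Y' : 'M[C]_N := Y *m Y' - Y' *m Y.

Definition torus T :=
  [/\ alg_group T, zconnected T &
      exists2 P, P \in unitmx & forall A, T A -> is_diag_mx (P *m A *m invmx P)].

Definition maximal_torus T G :=
  [/\ torus T, T `<=` G &
      forall T', torus T' -> T' `<=` G -> T `<=` T' -> T' = T].

Definition derived_subgroup H : set 'M[C]_N :=
  [set A | forall H', mxsubgroup H' ->
     (forall x y, H x -> H y -> H' (x *m y *m invmx x *m invmx y)) -> H' A].

Definition solvable_group H :=
  exists n, iter n derived_subgroup H `<=` [set 1%:M].

Definition borel B G :=
  [/\ alg_group B, zconnected B, solvable_group B, B `<=` G &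
      forall B', alg_group B' -> zconnected B' -> solvable_group B' ->
        B' `<=` G -> B `<=` B' -> B' = B].

(* Regular functions p / det ^ n on GL_N, and their differentials at 1. *)
Record regfun := Regfun { rnum : mxpolyfun; rden : nat }.
Definition rfev (f : regfun) A : C := pev (rnum f) A / \det A ^+ rden f.
Definition rdiff (f : regfun) Y : C :=
  pdiff (rnum f) Y - (rden f)%:R * \tr Y * pev (rnum f) 1%:M.

(* Characters of T are regular functions on GL_N, considered on T only. *)
Definition character T (f : regfun) :=
  rfev f 1%:M = 1 /\
  forall A A', T A -> T A' -> rfev f (A *m A') = rfev f A * rfev f A'.

(* Matrices z ^ -n * P(z) of Laurent polynomials in z. *)
Record lpolymx := Lpolymx { lpnum : 'M[{poly C}]_N; lpden : nat }.
Definition lpev (c : lpolymx) (z : C) : 'M[C]_N :=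
  (z ^+ lpden c)^-1 *: map_mx (fun p => p.[z]) (lpnum c).
(* The derivative at z = 1. *)
Definition lpdiff (c : lpolymx) : 'M[C]_N :=
  map_mx (fun p => p^`().[1]) (lpnum c)
  - (lpden c)%:R *: map_mx (fun p => p.[1]) (lpnum c).

Definition cocharacter T (c : lpolymx) :=
  (forall z, z != 0 -> T (lpev c z)) /\
  (forall z w, z != 0 -> w != 0 -> lpev c (z * w) = lpev c z *m lpev c w).

(* V = (cocharacter lattice) (x) R, embedded in Lie T by sending a cocharacter
   c to its derivative at 1.  For a character f and x in V, the pairing f(x)
   is then rdiff f x. *)
Definition Vspace T : set 'M[C]_N :=
  [set x | exists (n : nat) (r : 'I_n -> R) (c : 'I_n -> lpolymx),
     (forall i, cocharacter T (c i)) /\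
     x = \sum_(i < n) (r i)%:C%C *: lpdiff (c i)].

Definition e2pi (r : R) : C := (cos (2 * pi * r) +i* sin (2 * pi * r))%C.

(* A = exp(x), for x in V. *)
Definition is_exp T (x A : 'M[C]_N) :=
  T A /\ forall f, character T f -> rfev f A = e2pi (complex.Re (rdiff f x)).

Definition weight_vector T (f : regfun) Y :=
  forall A, T A -> A *m Y *m invmx A = rfev f A *: Y.

(* f is a root of T in H, for T contained in H. *)
Definition is_root H T (f : regfun) :=
  [/\ character T f, exists2 A, T A & rfev f A != 1 &
      exists2 Y, Lie H Y & Y != 0 /\ weight_vector T f Y].

Section RootDatum.
Variables (l : nat) (alpha : 'I_l -> regfun).

Definition simple_roots B T :=
  [/\ forall i, is_root B T (alpha i),
      forall f, is_root B T f -> exists n : 'I_l -> nat,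
        forall h, Lie T h -> rdiff f h = \sum_i (n i)%:R * rdiff (alpha i) h &
      forall a : 'I_l -> C,
        (forall h, Lie T h -> \sum_i a i * rdiff (alpha i) h = 0) ->
        forall i, a i = 0].

Definition pinning G T (E : 'I_l -> 'M[C]_N) :=
  forall i, [/\ Lie G (E i), E i != 0 & weight_vector T (alpha i) (E i)].

Definition root_combination G T (n : 'I_l -> int) :=
  exists2 f, is_root G T f &
    forall h, Lie T h -> rdiff f h = \sum_i (n i)%:~R * rdiff (alpha i) h.

(* An automorphism of R preserving Delta is determined by the permutation of
   Delta that it induces. *)
Definition root_automorphism G T (s : {perm 'I_l}) :=
  forall n : 'I_l -> int,
    root_combination G T n <-> root_combination G T (fun i => n ((s^-1)%g i)).

Definition lie_automorphism G (sigma : 'M[C]_N -> 'M[C]_N) :=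
  [/\ set_bij (Lie G) (Lie G) sigma,
      forall a Y Y', Lie G Y -> Lie G Y' ->
        sigma (a *: Y + Y') = a *: sigma Y + sigma Y' &
      forall Y Y', Lie G Y -> Lie G Y' ->
        sigma (bracket Y Y') = bracket (sigma Y) (sigma Y')].

(* sigma is the pinned automorphism of Lie G given by s in Aut(R, Delta); as a
   function, it matters on Lie G only. *)
Definition pinned_automorphism G T E (s : {perm 'I_l})
    (sigma : 'M[C]_N -> 'M[C]_N) :=
  [/\ root_automorphism G T s, lie_automorphism G sigma,
      forall h, Lie T h -> Lie T (sigma h) /\
        forall i, rdiff (alpha (s i)) (sigma h) = rdiff (alpha i) h &
      forall i, sigma (E i) = E (s i)].

Definition order_on (D : set 'M[C]_N) (f : 'M[C]_N -> 'M[C]_N) (n : nat) :=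
  [/\ (0 < n)%N, forall Y, D Y -> iter n f Y = Y &
      forall k, (0 < k < n)%N -> exists2 Y, D Y & iter k f Y <> Y].

Definition fixed (D : set 'M[C]_N) (sigma : 'M[C]_N -> 'M[C]_N) :=
  D `&` [set Y | sigma Y = Y].

(* Linear forms on a subspace D of Lie T are represented by functions on
   matrices, considered on D only.  On a simple Lie algebra, the trace form
   tr(xy) of a faithful representation is a positive multiple of the Killing
   form; it gives the invariant inner product used to compare root lengths. *)
Definition dual_vector (D : set 'M[C]_N) (b : 'M[C]_N -> C) (h : 'M[C]_N) :=
  D h /\ forall y, D y -> \tr (h *m y) = b y.

Section Restricted.
Variables (G T : set 'M[C]_N) (sigma : 'M[C]_N -> 'M[C]_N).
Implicit Types b c eta : 'M[C]_N -> C.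

Definition restricted_root : set ('M[C]_N -> C) :=
  [set b | exists2 f, is_root G T f &
     forall h, fixed (Lie T) sigma h -> b h = rdiff f h].

Definition short_root : set ('M[C]_N -> C) :=
  [set b | restricted_root b /\
     exists2 h, dual_vector (fixed (Lie T) sigma) b h &
       forall c k, restricted_root c ->
         dual_vector (fixed (Lie T) sigma) c k -> b h <= c k].

Definition highest_in (S : set ('M[C]_N -> C)) eta :=
  S eta /\ forall b, S b -> exists n : 'I_l -> nat,
    forall h, fixed (Lie T) sigma h ->
      eta h - b h = \sum_i (n i)%:R * rdiff (alpha i) h.

(* The Cartan integers 2(a_i, a_j)/(a_j, a_j) of Delta, for some numbering, are
   those of a chain of even length joined by simple edges. *)
Definition type_A_even :=
  ~~ odd l /\
  exists (p : {perm 'I_l}) (h : 'I_l -> 'M[C]_N),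
    (forall i, dual_vector (Lie T) (rdiff (alpha i)) (h i)) /\
    (forall i j : 'I_l, 2 * \tr (h (p i) *m h (p j)) =
       (if i == j then 2
        else if (i == j.+1 :> nat) || (j == i.+1 :> nat) then -1 else 0)
       * \tr (h (p j) *m h (p j))).

(* The linear form eta on (Lie T)^sigma, e being the order of sigma. *)
Definition is_eta (e : nat) eta :=
  [/\ e = 1%N -> highest_in restricted_root eta,
      e <> 1%N -> ~ type_A_even -> highest_in short_root eta &
      e <> 1%N -> type_A_even -> exists2 b, highest_in short_root b &
        forall h, fixed (Lie T) sigma h -> eta h = 2 * b h].

Definition in_alcove (e : nat) eta (x : 'M[C]_N) :=
  [/\ fixed (Vspace T) sigma x, forall i, 0 <= rdiff (alpha i) x &
      0 <= e%:R^-1 - eta x].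

End Restricted.
End RootDatum.

(* g_i and g_i(k), for theta of order m and the cocharacter lam. *)
Definition g_ G (theta : 'M[C]_N -> 'M[C]_N) (m i : nat) : set 'M[C]_N :=
  [set Y | Lie G Y /\ theta Y = e2pi (m%:R^-1) ^+ i *: Y].

Definition g_wt G theta m (lam : lpolymx) (i : nat) (k : int) : set 'M[C]_N :=
  [set Y | g_ G theta m i Y /\
     forall z, z != 0 -> lpev lam z *m Y *m invmx (lpev lam z) = z ^ k *: Y].

End AlgebraicGroups.

Section Connections.
Variables (R : realType) (N : nat).
Notation C := R[i].
Notation K := (laurent C).
Implicit Types (G : set 'M[C]_N) (A g : 'M[K]_N).

(* The points of G over C((s)): G is the spectrum of the ring of regular
   functions on GL_N modulo those vanishing on the complex points of G. *)
Definition Kpoints G : set 'M[K]_N :=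
  [set g | g \in unitmx /\ forall p, vanishes_on G p ->
     mpoly.mmap (@lconst C) (fun k => mxvec g 0 k) p = 0].

Definition mxlcoef (k : int) A : 'M[C]_N := map_mx (fun a : K => a k) A.

(* A connection on the trivial G-bundle over the formal punctured disc is
   d + A ds, given by A.  Changing the trivialization by g conjugates it by g. *)
Definition gauge g A : 'M[K]_N :=
  g *m A *m invmx g - map_mx (@lderiv C) g *m invmx g.

(* The pullback of d + A ds by s = u ^ b. *)
Definition ramify (b : nat) A : 'M[K]_N :=
  lderiv (lmono C b%:Z) *: map_mx (lsubst b) A.

(* An element of the Lie algebra of an algebraic subgroup of GL_N is nilpotent
   (resp. semisimple) when it is a nilpotent (resp. diagonalizable) matrix. *)
Definition nilpotent_mx (L : 'M[C]_N) := exists n : nat, L ^+ n = 0.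

(* Not equivalent, over C((s)), to a connection with at most a simple pole. *)
Definition irregular G A :=
  ~ exists2 g, Kpoints G g & forall k, k < -1 -> mxlcoef k (gauge g A) = 0.

(* Slope a / b; the fraction need not be in lowest terms. *)
Definition has_slope G A (a b : nat) :=
  [/\ (0 < a)%N, (0 < b)%N &
      exists2 g, Kpoints G g & let A' := gauge g (ramify b A) in
        (forall k, k < - (a.+1)%:Z -> mxlcoef k A' = 0) /\
        ~ nilpotent_mx (mxlcoef (- (a.+1)%:Z) A')].

(* d + sum_k X_k t ^ (e (1 - k) / m) dt / t for an invertible Laurent series
   t = t(s), as a connection d + A ds; the sum is over the list ks.  The
   exponents are integers whenever X_k != 0, so that the quotient is exact. *)
Definition theta_connection (e m : nat) (ks : seq int) (X_ : int -> 'M[C]_N)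
    (t : K) : 'M[K]_N :=
  (lderiv t / t) *:
  \sum_(k <- ks)
     t ^ ((e%:Z * (1 - k)) %/ m%:Z)%Z *: map_mx (@lconst C) (X_ k).

(* The coordinate t near t = oo, in terms of the parameter s = 1 / t. *)
Definition t_at_infinity : K := (lmono C 1)^-1.

End Connections.

(* Main.v *)
From HB Require Import structures.
Require Import Defs.
From mathcomp Require Import all_boot all_order all_algebra all_fingroup.
From mathcomp Require Import complex boolp classical_sets reals.
From mathcomp Require Import zify ring.
From mathcomp Require Import fsbigop trigo.
From mathcomp Require mpoly.
Set Implicit Arguments. Unset Strict Implicit. Unset Printing Implicit Defensive.
Import Order.TTheory GRing.Theory Num.Theory.
Local Open Scope ring_scope.

(* Near t = oo put t = u ^ -m.  Gauging by lambda(u ^ -e) multiplies X_k by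
   u ^ (-e k) and turns the connection into
     (- m X u ^ -(e+1) + e d(lambda) u ^ -1) du,
   whose polar part - m X is semisimple and nonzero.  The fractional exponents
   cause no trouble: since sigma fixes x it preserves the weights of lambda, so
   on g_1(k) it acts by xi_m ^ (1 - k), and sigma ^ e = 1 forces m | e (1 - k).
   The singularity is irregular because the iterated covariant derivatives along
   u d/du have poles of unbounded order. *)

(** The slope asks for a gauge element in G over the Laurent series, but membership of [lam] in the
    torus is given at nonzero complex numbers only. Each equation of G, pulled back along [lam], is
    therefore cleared of denominators: the resulting polynomial in z vanishes at every nonzero
    complex z, hence identically, hence also at the Laurent series u ^ -e. Its derivative at z = 1
    puts d(lambda) in Lie G.

    Weights are the second obstacle: sigma acts on the Lie algebra and not on the group.
    Diagonalizing T by one matrix P turns lambda(z) into diag(z ^ n_i) and d(lambda) into diag(n_i),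
    and both notions of weight k then say that n_i - n_j = k wherever the (i, j) entry is nonzero. A
    weight thus passes from conjugation to the bracket, through sigma, and back to conjugation by
    lambda(xi_m), which is exp(x).

    Irregularity excludes all trivializations at once, so it needs an invariant. With a simple pole,
    u d/du keeps any lower bound on orders, and a change of trivialization moves the bound for all
    iterates by one fixed amount. *)

Section LaurentTheory.
Variable F : comNzRingType.
Implicit Types (a b : laurent F) (c : F) (i k n p q : int).

Definition lord_ge q a := forall k, k < q -> a k = 0.

Lemma lord_exists a : exists q, lord_ge q a.
Proof. by case: (lcoefP a) => n hn; exists (- n%:Z). Qed.

Lemma lord_ge_le p q a : p <= q -> lord_ge q a -> lord_ge p a.
Proof. by move=> pq ha k kp; apply: ha; apply: lt_le_trans kp pq. Qed.

Lemma lcoef0 k : (0 : laurent F) k = 0. Proof. by rewrite /=; case: eqP. Qed.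

Lemma lcoefD a b k : (a + b) k = a k + b k. Proof. by []. Qed.

Lemma lcoef_sum I (r : seq I) (P : pred I) (G : I -> laurent F) k :
  (\sum_(i <- r | P i) G i) k = \sum_(i <- r | P i) G i k.
Proof.
elim/big_ind2: _ => //; first exact: lcoef0.
by move=> x x' y y' <- <-.
Qed.

Lemma lcoefM_seq a b k r : uniq r ->
  (forall i, i \notin r -> a i * b (k - i) = 0) ->
  (a * b) k = \sum_(i <- r) a i * b (k - i).
Proof.
move=> ur h; rewrite /= /lmulf (fsbigE r) //; last by move=> i _; apply: h.
by apply: eq_bigl => i; rewrite in_setT.
Qed.

(** Terms before the window vanish by the bound on [a], terms after it by the bound on [b]. Since
    any large enough [M] is allowed, several products can be expanded over one index range; [M = 0]
    and [M = 1] give the order and the lowest coefficient of a product. *)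
Lemma lcoefM a b n p k M : lord_ge n a -> lord_ge p b -> k < n + p + M%:Z ->
  (a * b) k = \sum_(0 <= j < M) a (j%:Z + n) * b (k - j%:Z - n).
Proof.
move=> ha hb hk.
rewrite (lcoefM_seq (r := [seq j%:Z + n | j <- index_iota 0 M])); first last.
- move=> i hi; have [/ha->|ni] := ltrP i n; first by rewrite mul0r.
  rewrite hb ?mulr0 // ltNge; apply: contra hi => hi.
  by apply/mapP; exists (absz (i - n)%R); rewrite ?mem_index_iota; lia.
- by rewrite map_inj_uniq ?iota_uniq // => x y; lia.
by rewrite big_map; apply: eq_bigr => j _; rewrite opprD addrA.
Qed.

Lemma lord_geM a b n p : lord_ge n a -> lord_ge p b -> lord_ge (n + p) (a * b).
Proof.
by move=> ha hb k hk; rewrite (lcoefM (M := 0) ha hb) ?big_geq //; lia.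
Qed.

Lemma lcoefM_low a b n p : lord_ge n a -> lord_ge p b ->
  (a * b) (n + p) = a n * b p.
Proof.
move=> ha hb; rewrite (lcoefM (M := 1) ha hb) ?big_nat1 //; last by lia.
by rewrite add0r subr0 addrC addKr.
Qed.

Lemma lmono_ord n : lord_ge n (lmono F n).
Proof. by move=> k kn /=; case: eqP => // e; rewrite e ltxx in kn. Qed.

Lemma lcoef_monoM n a k : (lmono F n * a) k = a (k - n).
Proof.
rewrite (lcoefM_seq (r := [:: n])) //=; last first.
  by move=> i; rewrite inE => /negPf->; rewrite mul0r.
by rewrite big_seq1 eqxx mul1r.
Qed.

Lemma lcoef_constM c a k : (lconst c * a) k = c * a k.
Proof.
rewrite (lcoefM_seq (r := [:: 0])) //=; last first.
  by move=> i; rewrite inE => /negPf->; rewrite mul0r.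
by rewrite big_seq1 eqxx subr0.
Qed.

Fact lconst_zmod : zmod_morphism (@lconst F).
Proof. by move=> c d; apply: laurentP => k /=; case: eqP; rewrite ?subr0. Qed.

Fact lconst_monoid : monoid_morphism (@lconst F).
Proof.
split=> // c d; apply: laurentP => k; rewrite lcoef_constM /=.
by case: eqP; rewrite ?mulr0.
Qed.

HB.instance Definition _ := GRing.isZmodMorphism.Build _ _ _ lconst_zmod.
HB.instance Definition _ := GRing.isMonoidMorphism.Build _ _ _ lconst_monoid.

Lemma lmono0 : lmono F 0 = 1. Proof. exact: laurentP. Qed.

Lemma lmono_unit n : lmono F n \is a GRing.unit.
Proof.
by apply/unitrPr; exists (lmono F (- n)); rewrite lmonoD subrr lmono0.
Qed.

Lemma lmonoX n (d : nat) : lmono F n ^+ d = lmono F (n * d%:Z).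
Proof.
elim: d => [|d ih]; first by rewrite expr0 mulr0 lmono0.
by rewrite exprS ih lmonoD; congr lmono; lia.
Qed.

Lemma lmonoXz n p : lmono F n ^ p = lmono F (n * p).
Proof.
case: p => d; first exact: lmonoX.
by rewrite NegzE -exprnN lmonoX lmonoV mulrN.
Qed.

Fact lderiv_zmod : zmod_morphism (@lderiv F).
Proof. by move=> a b; apply: laurentP => k /=; rewrite mulrzBl. Qed.

HB.instance Definition _ := GRing.isZmodMorphism.Build _ _ _ lderiv_zmod.

Lemma lderivE a k : lderiv a k = a (k + 1) *~ (k + 1). Proof. by []. Qed.

Lemma lderiv_ord q a : lord_ge q a -> lord_ge (q - 1) (lderiv a).
Proof. by move=> ha k hk; rewrite lderivE ha ?mul0rz //; lia. Qed.

Lemma lderivM a b : lderiv (a * b) = lderiv a * b + a * lderiv b.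
Proof.
have [n ha] := lord_exists a; have [p hb] := lord_exists b.
apply: laurentP => k; rewrite lcoefD lderivE.
(* One length serves all three products: differentiation lowers an order by one, and the left side
   is read one degree higher. *)
pose M := absz (k + 2 - n - p)%R.
have [ha' hb'] := (lderiv_ord ha, lderiv_ord hb).
rewrite (lcoefM (M := M) ha hb); last by rewrite /M; lia.
rewrite (lcoefM (M := M) ha' hb); last by rewrite /M; lia.
rewrite (lcoefM (M := M) ha hb'); last by rewrite /M; lia.
rewrite -big_split mulrz_suml; apply: eq_bigr => j _ /=.
have -> : j%:Z + (n - 1) + 1 = j%:Z + n by lia.
have -> : k - j%:Z - (n - 1) = k + 1 - j%:Z - n by lia.
have -> : k - j%:Z - n + 1 = k + 1 - j%:Z - n by lia.
by rewrite mulrzAl mulrzAr -mulrzDr; congr (_ *~ _); lia.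
Qed.

Lemma lderiv_const c : lderiv (lconst c) = 0.
Proof.
by apply: laurentP => k; rewrite lderivE lcoef0 /=; case: eqP => [->|_]; rewrite ?mul0rz.
Qed.

Lemma lderiv_mono n : lderiv (lmono F n) = lconst n%:~R * lmono F (n - 1).
Proof.
apply: laurentP => k; rewrite lcoef_constM /=.
have -> : (k == n - 1) = (k + 1 == n) by apply/eqP/eqP; lia.
by case: eqP => [->|_]; rewrite ?mulr1 // mul0rz mulr0.
Qed.

Section Substitution.
Variable b : nat.
Hypothesis b_gt0 : (0 < b)%N.

Lemma lsubstE a k :
  lsubst b a k = if (b%:Z %| k)%Z then a (k %/ b%:Z)%Z else 0.
Proof. by rewrite /= prednK. Qed.

Lemma lsubst_mulE a k : lsubst b a (b%:Z * k) = a k.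
Proof. by rewrite lsubstE dvdz_mulr // mulKz //; lia. Qed.

Lemma lsubst_ord a n : lord_ge n a -> lord_ge (b%:Z * n) (lsubst b a).
Proof.
move=> ha k hk; rewrite lsubstE; case: ifP => // /dvdzP[q kE].
rewrite kE mulzK; last by lia.
by rewrite ha //; move: hk; rewrite kE mulrC ltr_pM2l //; lia.
Qed.

Lemma lsubst_zmod : zmod_morphism (@lsubst F b).
Proof.
by move=> a c; apply: laurentP => k /=; case: ifP => // _; rewrite subr0.
Qed.

(** If [b] does not divide [k], every term of the convolution has an index not divisible by [b] and
    vanishes. Otherwise only the indices [b * i'] contribute, and they reproduce the convolution of
    [a] and [c]. *)
Lemma lsubst_monoid : monoid_morphism (@lsubst F b).
Proof.
split=> [|a c].
  apply: laurentP => k; rewrite lsubstE /=; case: ifP => [/dvdzP[q ->]|/negP h].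
    by rewrite mulzK ?mulf_eq0; [congr (if _ then _ else _); lia|lia].
  by case: eqP => // k0; case: h; rewrite k0 dvdz0.
have [n ha] := lord_exists a; have [p hc] := lord_exists c.
apply: laurentP => k; rewrite lsubstE; case: ifP => [/dvdzP[q ->]|/negP h]; last first.
  rewrite (lcoefM_seq (r := [::])) ?big_nil // => i _.
  rewrite !lsubstE; case: ifP => hi; last by rewrite mul0r.
  by case: ifP => hki; rewrite ?mulr0 //; case: h; rewrite -(subrK i k) rpredD.
rewrite mulzK; last by lia.
pose M := absz (q + 1 - n - p)%R.
rewrite (lcoefM (M := M) ha hc); last by rewrite /M; lia.
rewrite (lcoefM_seq (r := [seq b%:Z * (j%:Z + n) | j <- index_iota 0 M])); first last.
- move=> i hi; rewrite [lsubst b a _]lsubstE; case: ifP => [/dvdzP[i' iE]|_]; last by rewrite mul0r.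
  rewrite iE mulzK; last by lia.
  rewrite -mulrBl mulrC (mulrC _ b%:Z) lsubst_mulE mulrC.
  have [/ha->|ni] := ltrP i' n; first by rewrite mul0r.
  rewrite hc ?mulr0 // ltNge; apply: contra hi => hi.
  apply/mapP; exists (absz (i' - n)%R); first by rewrite mem_index_iota; lia.
  by rewrite iE mulrC; congr (_ * _); lia.
- rewrite map_inj_uniq ?iota_uniq // => x y /mulfI; have : b%:Z != 0 by lia.
  by move=> -> // /(_ isT); lia.
rewrite big_map; apply: eq_bigr => j _; rewrite lsubst_mulE.
by rewrite (mulrC q) -mulrBr lsubst_mulE opprD addrA.
Qed.

Lemma lsubst_const c : lsubst b (lconst c) = lconst c.
Proof.
apply: laurentP => k; rewrite lsubstE /=; case: ifP => [/dvdzP[q ->]|/negP h].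
  by rewrite mulzK ?mulf_eq0; [congr (if _ then _ else _); lia|lia].
by case: eqP => // k0; case: h; rewrite k0 dvdz0.
Qed.

Lemma lsubst_mono n : lsubst b (lmono F n) = lmono F (b%:Z * n).
Proof.
apply: laurentP => k; rewrite lsubstE /=; case: ifP => [/dvdzP[q ->]|/negP h].
  rewrite mulzK; last by lia.
  by rewrite mulrC (inj_eq (mulfI _)) //; lia.
by case: eqP => // k0; case: h; rewrite k0 dvdz_mulr.
Qed.

(** The chain rule for s = u ^ b; its factor is the one by which [ramify] multiplies a
    connection. *)
Lemma lderiv_lsubst a :
  lderiv (lsubst b a) = lderiv (lmono F b%:Z) * lsubst b (lderiv a).
Proof.
apply: laurentP => k; rewrite lderiv_mono -mulrA lcoef_constM lcoef_monoM.
have -> : k - (b%:Z - 1) = k + 1 - b%:Z by lia.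
rewrite lderivE !lsubstE rpredBr ?dvdzz //.
case: ifP => [/dvdzP[q ->]|_]; last by rewrite mul0rz mulr0.
have -> : q * b%:Z - b%:Z = (q - 1) * b%:Z by rewrite mulrBl mul1r.
rewrite !mulzK; [|lia|lia].
by rewrite lderivE subrK mulrzl -mulrzA.
Qed.

End Substitution.

(** At [b = 0] the definition substitutes with exponent [0.-1.+1 = 1], so the morphism structure can
    be declared for every [b]. *)
Fact lsubst_zmod_total (b : nat) : zmod_morphism (@lsubst F b).
Proof. by case: b => [|b]; [exact: (@lsubst_zmod 1)|exact: lsubst_zmod]. Qed.

Fact lsubst_monoid_total (b : nat) : monoid_morphism (@lsubst F b).
Proof. by case: b => [|b]; [exact: (@lsubst_monoid 1)|exact: lsubst_monoid]. Qed.

HB.instance Definition _ (b : nat) := GRing.isZmodMorphism.Build _ _ _ (lsubst_zmod_total b).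
HB.instance Definition _ (b : nat) := GRing.isMonoidMorphism.Build _ _ _ (lsubst_monoid_total b).
End LaurentTheory.

Section InverseMatrix.
Variables (S : comUnitRingType) (N : nat).

Lemma mulmx1_invmx (A B : 'M[S]_N) : A *m B = 1%:M -> A \in unitmx /\ invmx A = B.
Proof.
move=> AB; have [uA _] := mulmx1_unit AB.
by split=> //; rewrite -[LHS]mulmx1 -AB mulKmx.
Qed.

Lemma map_mx_unit_inv (S' : comUnitRingType) (f : {rmorphism S' -> S}) (g : 'M[S']_N) :
  g \in unitmx ->
  map_mx f g \in unitmx /\ invmx (map_mx f g) = map_mx f (invmx g).
Proof. by move=> ug; apply: mulmx1_invmx; rewrite -map_mxM mulmxV // map_mx1. Qed.

End InverseMatrix.

(** * Pole orders of matrices, covariant derivatives and irregularity *)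

Section Slope.
Variables (R : realType) (N : nat).
Local Notation C := R[i].
Local Notation K := (laurent C).
Implicit Types (A M g : 'M[K]_N) (G : set 'M[C]_N) (k p q : int).

Definition mxord_ge q M := forall k, k < q -> mxlcoef k M = 0.

Lemma mxord_geP q M : mxord_ge q M <-> forall i j, lord_ge q (M i j).
Proof.
split=> [h i j k /h/matrixP/(_ i j)|h k kq]; first by rewrite !mxE.
by apply/matrixP => i j; rewrite !mxE h.
Qed.

Lemma mxord_exists M : exists q, mxord_ge q M.
Proof.
have [f hf] := choice (fun ij : 'I_N * 'I_N => lord_exists (M ij.1 ij.2)).
exists (- \sum_ij `|f ij|); apply/mxord_geP => i j; apply: lord_ge_le (hf (i, j)).
rewrite (bigD1 (i, j)) //=.
have : 0 <= \sum_(ij | ij != (i, j)) `|f ij| by apply: sumr_ge0.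
set S := (\sum_(_ | _) _)%R; lia.
Qed.

Lemma mxord_ge_le p q M : p <= q -> mxord_ge q M -> mxord_ge p M.
Proof. by move=> pq h k kp; apply: h; apply: lt_le_trans kp pq. Qed.

Lemma mxlcoefD k A M : mxlcoef k (A + M) = mxlcoef k A + mxlcoef k M.
Proof. by apply/matrixP => i j; rewrite !mxE. Qed.

Lemma mxord_geD q A M : mxord_ge q A -> mxord_ge q M -> mxord_ge q (A + M).
Proof. by move=> hA hM k kq; rewrite mxlcoefD hA // hM // addr0. Qed.

Lemma mxord_geM p q A M : mxord_ge p A -> mxord_ge q M -> mxord_ge (p + q) (A *m M).
Proof.
move=> /mxord_geP hA /mxord_geP hM; apply/mxord_geP => i j k kq.
by rewrite mxE lcoef_sum big1 // => l _; rewrite (lord_geM (hA i l) (hM l j)).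
Qed.

Lemma mxlcoefM_low p q A M : mxord_ge p A -> mxord_ge q M ->
  mxlcoef (p + q) (A *m M) = mxlcoef p A *m mxlcoef q M.
Proof.
move=> /mxord_geP hA /mxord_geP hM; apply/matrixP => i j.
rewrite !mxE lcoef_sum; apply: eq_bigr => l _.
by rewrite (lcoefM_low (hA i l) (hM l j)) !mxE.
Qed.

Lemma mxlcoef_monoZ n k M : mxlcoef k (lmono C n *: M) = mxlcoef (k - n) M.
Proof. by apply/matrixP => i j; rewrite !mxE lcoef_monoM. Qed.

Lemma mxord_geZ n q M : mxord_ge q M -> mxord_ge (n + q) (lmono C n *: M).
Proof. by move=> hM k hk; rewrite mxlcoef_monoZ hM //; lia. Qed.

Lemma mxord_ge1 : mxord_ge 0 (1%:M : 'M[K]_N).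
Proof.
apply/mxord_geP => i j; rewrite mxE -lmono0; case: eqP => _; first exact: lmono_ord.
by move=> k _; apply: lcoef0.
Qed.

Lemma mxlcoef1 : mxlcoef 0 (1%:M : 'M[K]_N) = 1%:M.
Proof. by apply/matrixP => i j; rewrite !mxE; case: eqP; rewrite /= ?eqxx. Qed.

Lemma map_lderivM A M :
  map_mx (@lderiv C) (A *m M) = map_mx (@lderiv C) A *m M + A *m map_mx (@lderiv C) M.
Proof.
apply/matrixP => i j; rewrite !mxE raddf_sum -big_split; apply: eq_bigr => l _.
by rewrite /= lderivM !mxE.
Qed.

(* The covariant derivative along u d/du of the connection d + A du. *)
Definition covd A M := lmono C 1 *: (map_mx (@lderiv C) M + A *m M).

(** The derivative of [g] produced by the product rule cancels against the inhomogeneous term of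
    [gauge]. *)
Lemma covd_gauge g A M : g \in unitmx -> g *m covd A M = covd (gauge g A) (g *m M).
Proof.
move=> ug; rewrite /covd -scalemxAr; congr (_ *: _).
rewrite map_lderivM mulmxDr /gauge mulmxBl -!mulmxA mulKmx // .
by rewrite [RHS]addrC addrA subrK addrC.
Qed.

Lemma iter_covd_gauge g A M n : g \in unitmx ->
  g *m iter n (covd A) M = iter n (covd (gauge g A)) (g *m M).
Proof. by move=> ug; elim: n => //= n <-; rewrite covd_gauge. Qed.

(** Both sides follow the frame [invmx g1] of the original trivialization. The correcting factors do
    not depend on [n], so they shift pole orders by a bounded amount. *)
Lemma iter_covd_gauge1 g1 g2 A n : g1 \in unitmx -> g2 \in unitmx ->
  iter n (covd (gauge g1 A)) 1%:M =
  g1 *m invmx g2 *m iter n (covd (gauge g2 A)) (g2 *m invmx g1).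
Proof.
move=> ug1 ug2; rewrite -{1}(mulmxV ug1).
have e1 := iter_covd_gauge A (invmx g1) n ug1.
have e2 := iter_covd_gauge A (invmx g1) n ug2.
apply: etrans (esym e1) (etrans _ (mulmxA _ _ _)).
have e3 := canRL (mulKmx ug2) e2.
exact (congr1 (mulmx g1) e3).
Qed.

Lemma map_lderiv_ord q M : mxord_ge q M -> mxord_ge (q - 1) (map_mx (@lderiv C) M).
Proof.
move=> /mxord_geP hM; apply/mxord_geP => i j; rewrite mxE; exact: lderiv_ord.
Qed.

Lemma covd_ord a q A M : 0 <= a -> mxord_ge (- (a + 1)) A -> mxord_ge q M ->
  mxord_ge (q - a) (covd A M).
Proof.
move=> a0 hA hM; have -> : q - a = 1 + (- (a + 1) + q) by lia.
apply: mxord_geZ; apply: mxord_geD (mxord_geM hA hM).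
by apply: mxord_ge_le (map_lderiv_ord hM); lia.
Qed.

(** Since [a > 0], the term u dM/du has order at least [q] and does not reach degree [q - a]: only
    the product with [A] does. *)
Lemma covd_low a q A M : 0 < a -> mxord_ge (- (a + 1)) A -> mxord_ge q M ->
  mxlcoef (q - a) (covd A M) = mxlcoef (- (a + 1)) A *m mxlcoef q M.
Proof.
move=> a0 hA hM; rewrite mxlcoef_monoZ mxlcoefD.
have -> : q - a - 1 = - (a + 1) + q by lia.
by rewrite mxlcoefM_low // (map_lderiv_ord hM) ?add0r //; lia.
Qed.

Lemma iter_covd_regular q A M n : mxord_ge (- 1) A -> mxord_ge q M ->
  mxord_ge q (iter n (covd A) M).
Proof.
move=> hA hM; elim: n => //= n ih.
by rewrite -[q]subr0; apply: covd_ord; rewrite ?add0r.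
Qed.

Lemma iter_covd_irregular (a : nat) A n : (0 < a)%N -> mxord_ge (- a.+1%:Z) A ->
  mxord_ge (- (n * a)%:Z) (iter n (covd A) 1%:M) /\
  mxlcoef (- (n * a)%:Z) (iter n (covd A) 1%:M) = mxlcoef (- a.+1%:Z) A ^+ n.
Proof.
have -> : - a.+1%:Z = - (a%:Z + 1) by lia.
move=> a0 hA; elim: n => /= [|n [ih1 ih2]].
  by rewrite mul0n oppr0 expr0; split; [exact: mxord_ge1|exact: mxlcoef1].
have -> : - (n.+1 * a)%:Z = - (n * a)%:Z - a%:Z by lia.
by split; [apply: covd_ord | rewrite covd_low // exprS ih2].
Qed.

Lemma ramify_gauge b g A : (0 < b)%N -> g \in unitmx ->
  ramify b (gauge g A) = gauge (map_mx (lsubst b) g) (ramify b A).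
Proof.
move=> b0 ug; rewrite /gauge (map_mx_unit_inv (lsubst b : {rmorphism K -> K}) ug).2.
have -> : map_mx (@lderiv C) (map_mx (lsubst b) g) = ramify b (map_mx (@lderiv C) g).
  by apply/matrixP => i j; rewrite !mxE lderiv_lsubst.
by rewrite /ramify !(map_mxB, map_mxM) scalerBr -!(scalemxAl, scalemxAr).
Qed.

Lemma ramify_simple_pole b A : (0 < b)%N -> mxord_ge (- 1) A -> mxord_ge (- 1) (ramify b A).
Proof.
move=> b0 /mxord_geP hA; apply/mxord_geP => i j; rewrite !mxE lderiv_mono -mulrA.
move=> k hk; rewrite lcoef_constM lcoef_monoM (lsubst_ord b0 (hA i j)) ?mulr0 //; lia.
Qed.

(* Iterated covariant derivatives have bounded poles when the pole is simple in
   some trivialization, whereas a non-nilpotent polar part of order a + 1 > 1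
   gives the n-th one a pole of order exactly n a. *)
Lemma slope_irregular G A a b : has_slope G A a b -> irregular G A.
Proof.
move=> [a0 b0 [g1 [ug1 _] /= [hord hnil]]] [g2 [ug2 _] hreg].
set A' := gauge g1 _ in hord hnil.
(* The two trivializations live on different discs; the regular one is pulled back to the cover,
   where its pole stays simple. *)
have hreg' := ramify_simple_pole b0 hreg; rewrite ramify_gauge // in hreg'.
have [] := map_mx_unit_inv (lsubst b : {rmorphism K -> K}) ug2.
set g := map_mx _ _ in hreg' * => ug _.
have [p hp] := mxord_exists (g *m invmx g1).
have [q hq] := mxord_exists (g1 *m invmx g).
(* As [a >= 1], this gives [- (n * a) < q + p]: the coefficient equal to the [n]-th power of the
   polar part lies below the uniform bound, hence is zero. *)
pose n := (absz (q + p)%R).+1.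
have ord_n : mxord_ge (q + p) (iter n (covd A') 1%:M).
  rewrite (iter_covd_gauge1 _ _ ug1 ug).
  by apply: mxord_geM hq _; apply: iter_covd_regular.
case: hnil; exists n; have [_ <-] := iter_covd_irregular n a0 hord.
by apply: ord_n; rewrite /n; nia.
Qed.

End Slope.

(** * Polynomial identities tested at nonzero numbers *)

Section PolynomialIdentities.

(** The numbers 1, ..., [size q] are distinct and nonzero: too many roots for a nonzero [q]. *)
Lemma poly_eq0_nonzero (F : numDomainType) (q : {poly F}) :
  (forall z, z != 0 -> q.[z] = 0) -> q = 0.
Proof.
move=> hq; apply/eqP; apply: contraT => q0.
have := @max_poly_roots _ _ [seq i.+1%:R | i <- iota 0 (size q)] q0.
rewrite size_map size_iota ltnn; apply.
  by apply/allP => _ /mapP[i _ ->]; rewrite rootE hq // pnatr_eq0.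
rewrite map_inj_uniq ?iota_uniq // => i j /eqP.
by rewrite eqr_nat => /eqP[].
Qed.

(** For fixed w, q(z w) = q(w) q(z) is an identity of polynomials in z; comparing leading
    coefficients gives q(w) = w ^ deg q. *)
Lemma multiplicative_poly (F : numFieldType) (q : {poly F}) : q != 0 ->
  (forall z w, z != 0 -> w != 0 -> q.[z * w] = q.[z] * q.[w]) ->
  exists c, q = 'X^c.
Proof.
move=> q0 hq; exists (size q).-1; apply/eqP; rewrite -subr_eq0; apply/eqP.
apply: poly_eq0_nonzero => w w0; rewrite !hornerE; apply/eqP.
rewrite subr_eq0; apply/eqP.
have : \poly_(i < size q) (q`_i * w ^+ i) = q.[w] *: q.
  apply/eqP; rewrite -subr_eq0; apply/eqP; apply: poly_eq0_nonzero => z z0.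
  rewrite !hornerE mulrC -hq // horner_poly horner_coef -sumrB big1 // => i _.
  by rewrite exprMn; ring.
move/(congr1 (fun p : {poly F} => p`_(size q).-1)); rewrite coef_poly coefZ ifT.
  by rewrite mulrC -lead_coefE => /mulIf; rewrite lead_coef_eq0 => /(_ q0).
by rewrite prednK // size_poly_gt0.
Qed.

Lemma deriv_prod (F : comNzRingType) (I : eqType) (r : seq I) (G : I -> {poly F}) :
  uniq r ->
  (\prod_(i <- r) G i)^`() = \sum_(i <- r) (G i)^`() * \prod_(j <- r | j != i) G j.
Proof.
elim: r => [|x r ih] /=; first by rewrite !big_nil derivC.
move=> /andP[xr ur]; rewrite !big_cons derivM ih // eqxx /=; congr (_ + _).
  rewrite [in RHS]big_seq_cond [in LHS]big_seq_cond; congr (_ * _).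
  by apply: eq_bigl => j; case jr: (j \in r) => //=; case: eqP jr xr => // -> ->.
rewrite mulr_sumr; apply: eq_big_seq => i ir; rewrite big_cons.
have -> : x != i by apply: contraNneq xr => ->.
exact: mulrCA.
Qed.

End PolynomialIdentities.

(** * Clearing denominators in polynomial equations along a Laurent curve *)

Section Homogenization.
Import (canonicals) mpoly.
Variables (F : numFieldType) (n d : nat) (v : 'I_n -> {poly F}).
Implicit Type p : mpoly.mpoly n F.
Local Notation mexp := mpoly.fun_of_multinom.
Local Notation monomial m := (\prod_(i < n) v i ^+ mexp m i).

Definition homog_deg p : nat := d * \max_(m <- mpoly.msupp p) mpoly.mdeg m.

Lemma mdeg_le_homog_deg p m : m \in mpoly.msupp p ->
  (d * mpoly.mdeg m <= homog_deg p)%N.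
Proof. by move=> mp; apply: leq_mul => //; apply: leq_bigmax_seq. Qed.

(* The polynomial z ^ homog_deg p * p(z ^ -d v(z)). *)
Definition homog p : {poly F} :=
  \sum_(m <- mpoly.msupp p)
     mpoly.mcoeff m p *: ('X^(homog_deg p - d * mpoly.mdeg m) * monomial m).

(** The ring [S] is arbitrary because the identity is used twice: over the complex numbers, to show
    that [homog p] is zero, and over another algebra, to draw the consequence there. *)
Lemma homogE (S : comUnitRingType) (f : {rmorphism F -> S}) (z : S) p :
  z \is a GRing.unit ->
  (map_poly f (homog p)).[z] = z ^+ homog_deg p *
    mpoly.mmap f (fun k => (z ^+ d)^-1 * (map_poly f (v k)).[z]) p.
Proof.
move=> uz; rewrite rmorph_sum horner_sum /mpoly.mmap mulr_sumr.
apply: eq_big_seq => m /mdeg_le_homog_deg hm.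
rewrite /= map_polyZ hornerZ mulrCA rmorphM /= map_polyXn hornerM hornerXn; congr (_ * _).
rewrite rmorph_prod horner_prod /mpoly.mmap1.
rewrite (eq_bigr _ (fun i _ => exprMn _ _ _)) big_split prodrXr -mpoly.mdegE mulrA; congr (_ * _).
  by rewrite exprVn -exprM exprB.
by apply: eq_bigr => i _; rewrite rmorphXn /= horner_exp.
Qed.

(** By linearity a monomial suffices, and there Euler's relation turns the degree removed from the
    power of z into a sum of partial derivatives. The factor of the k-th partial is the derivative
    at 1 of z ^ -d v_k(z), an entry of [lpdiff] in the application. *)
Lemma deriv_homog p : (homog p)^`().[1] =
  (homog_deg p)%:R * mpoly.meval (fun k => (v k).[1]) p +
  \sum_k ((v k)^`().[1] - d%:R * (v k).[1]) *
     mpoly.meval (fun k => (v k).[1]) (mpoly.mderiv k p).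
Proof.
set D := homog_deg p; set V := fun k => (v k).[1].
transitivity (\sum_(m <- mpoly.msupp p) mpoly.mcoeff m p *
   (D%:R * mpoly.meval V (mpoly.mpolyX F m) +
    \sum_k ((v k)^`().[1] - d%:R * (v k).[1]) *
       mpoly.meval V (mpoly.mderiv k (mpoly.mpolyX F m)))); last first.
  rewrite [in X in _ = _ * X + _](mpoly.mpolyE p) raddf_sum mulr_sumr.
  have devE k : mpoly.meval V (mpoly.mderiv k p) = \sum_(m <- mpoly.msupp p)
      mpoly.mcoeff m p * mpoly.meval V (mpoly.mderiv k (mpoly.mpolyX F m)).
    rewrite {1}(mpoly.mpolyE p) (raddf_sum (mpoly.mderiv k)) (raddf_sum (mpoly.meval V)) /=.
    apply: eq_bigr => m _.
    by rewrite mpoly.mderivZ mpoly.mevalZ.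
  under [X in _ = _ + X]eq_bigr => k _ do rewrite devE mulr_sumr.
  rewrite exchange_big -big_split; apply: eq_bigr => m _ /=.
  rewrite mpoly.mevalZ mulrDr mulrCA; congr (_ + _).
  by rewrite mulr_sumr; apply: eq_bigr => k _; rewrite mulrCA.
rewrite raddf_sum horner_sum; apply: eq_big_seq => m /mdeg_le_homog_deg hm.
rewrite /= derivZ hornerZ; congr (_ * _).
rewrite derivM hornerD !hornerM derivXn hornerMn !hornerXn !expr1n mul1r.
set W := \prod_(i < n) V i ^+ mexp m i.
have WE : (monomial m).[1] = W.
  by rewrite horner_prod; apply: eq_bigr => i _; rewrite horner_exp.
have mevX m' : mpoly.meval V (mpoly.mpolyX F m') = \prod_(i < n) V i ^+ mexp m' i.
  exact: mpoly.mevalX.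
rewrite WE mevX natrB //.
rewrite deriv_prod ?index_enum_uniq // horner_sum.
pose U k := (mexp m k)%:R * (V k ^+ (mexp m k).-1 * \prod_(j < n | j != k) V j ^+ mexp m j).
have UE k : U k = mpoly.meval V (mpoly.mderiv k (mpoly.mpolyX F m)).
  rewrite mpoly.mderivX mpoly.mevalZ mevX /U; congr (_ * _).
  rewrite [RHS](bigD1 k) //= mpoly.mnmBE mpoly.mnm1E eqxx subn1; congr (_ * _).
  by apply: eq_bigr => j jk; rewrite mpoly.mnmBE mpoly.mnm1E eq_sym (negPf jk) subn0.
have UV k : V k * U k = (mexp m k)%:R * W.
  rewrite /U /W [in RHS](bigD1 k) //=.
  by case: (mexp m k) => [|c]; rewrite ?mul0r ?mulr0 //= exprS mulrCA !mulrA.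
have -> : \sum_i ((v i ^+ mexp m i)^`() * \prod_(j < n | j != i) v j ^+ mexp m j).[1]
    = \sum_i (v i)^`().[1] * U i.
  apply: eq_bigr => i _; rewrite deriv_exp hornerM hornerMn hornerM horner_exp horner_prod.
  under eq_bigr do rewrite horner_exp.
  by rewrite /U -[_ *+ _]mulr_natl; ring.
have -> : \sum_k ((v k)^`().[1] - d%:R * (v k).[1]) *
      mpoly.meval V (mpoly.mderiv k (mpoly.mpolyX F m))
    = \sum_k (v k)^`().[1] * U k - d%:R * (mpoly.mdeg m)%:R * W.
  rewrite mpoly.mdegE natr_sum mulr_sumr mulr_suml -sumrB; apply: eq_bigr => k _.
  by rewrite -UE mulrBl -!(mulrA d%:R) -/(V k) UV.
by rewrite natrM -/D -/W mulrBl addrAC addrA.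
Qed.

End Homogenization.

(** * Cocharacters over arbitrary algebras and their diagonal form *)

Section LaurentCurves.
Variables (R : realType) (N : nat).
Local Notation C := R[i].
Implicit Types (c : lpolymx R N) (G T H : set 'M[C]_N) (P Y : 'M[C]_N).

(* The analogue of lpev over a C-algebra S. *)
Definition lpev_in (S : comUnitRingType) (f : {rmorphism C -> S}) c (z : S) : 'M[S]_N :=
  (z ^+ lpden c)^-1 *: map_mx (horner_eval z \o map_poly f) (lpnum c).

Lemma lpev_in_id c z : lpev_in idfun c z = lpev c z.
Proof.
congr (_ *: _); apply/matrixP => i j; rewrite !mxE /= /horner_eval.
by rewrite map_poly_id.
Qed.

Local Notation coefs c := (fun k => mxvec (lpnum c) 0 k).

Lemma mxvec_lpev_in (S : comUnitRingType) (f : {rmorphism C -> S}) c (z : S) k :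
  mxvec (lpev_in f c z) 0 k = (z ^+ lpden c)^-1 * (map_poly f (mxvec (lpnum c) 0 k)).[z].
Proof. by case/mxvec_indexP: k => i j; rewrite !mxvecE !mxE. Qed.

Section InGroup.
Variables (H : set 'M[C]_N) (c : lpolymx R N).
Hypothesis Hc : forall z, z != 0 -> H (lpev c z).

Lemma homog_vanishing p : vanishes_on H p -> homog (lpden c) (coefs c) p = 0.
Proof.
move=> pH; apply: poly_eq0_nonzero => z z0.
have := @homogE _ _ (lpden c) (coefs c) _ idfun z p.
rewrite unitfE map_poly_id // => -> //.
have := pH _ (Hc z0); rewrite /pev /mpoly.meval => hp.
rewrite -[X in _ * X]/(mpoly.mmap _ _ _).
suff -> : (fun k => (z ^+ lpden c)^-1 * (map_poly idfun (mxvec (lpnum c) 0 k)).[z])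
    = (fun k => mxvec (lpev c z) 0 k) by rewrite hp mulr0.
by apply: funext => k; rewrite -lpev_in_id mxvec_lpev_in.
Qed.

(** The zero polynomial [homog p] also vanishes at [z], and the power of the unit [z] cancels. With
    Laurent series for [S], this yields points in [Kpoints]. *)
Lemma lpev_in_vanishing (S : comUnitRingType) (f : {rmorphism C -> S}) (z : S) p :
  z \is a GRing.unit -> vanishes_on H p ->
  mpoly.mmap f (fun k => mxvec (lpev_in f c z) 0 k) p = 0.
Proof.
move=> uz /homog_vanishing h; have := homogE (lpden c) (coefs c) f p uz.
rewrite h rmorph0 horner0; under eq_fun => k do rewrite -mxvec_lpev_in.
move/esym => e; apply: (mulrI (unitrX (homog_deg (lpden c) p) uz)).
by rewrite e mulr0.
Qed.

(** Differentiate [homog p = 0] at z = 1: the term proportional to p(1) drops out because the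
    identity lies in [H], and what remains is [pdiff]. *)
Lemma lpdiff_Lie : lpev c 1 = 1%:M -> Lie H (lpdiff c).
Proof.
move=> c1 p pH; have c1' : map_mx (fun q : {poly C} => q.[1]) (lpnum c) = 1%:M.
  by rewrite -c1 /lpev expr1n invr1 scale1r.
have vE : (fun k => (mxvec (lpnum c) 0 k).[1]) = (fun k => mxvec (1%:M : 'M[C]_N) 0 k).
  by apply: funext => k; case/mxvec_indexP: k => i j; rewrite !mxvecE -c1' mxE.
have := deriv_homog (lpden c) (coefs c) p.
rewrite homog_vanishing // derivC horner0 vE -[mpoly.meval _ p]/(pev p 1%:M).
rewrite pH -?c1 //; last by apply: Hc; apply: oner_neq0.
rewrite mulr0 add0r => /esym <-; rewrite /pdiff pair_bigA /=.
rewrite (reindex _ (curry_mxvec_bij N N)) /=; apply: eq_bigr => -[i j] _ /=.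
by rewrite /lpdiff !mxE !mxvecE c1.
Qed.

End InGroup.

Lemma is_diag_mulmxE (A B : 'M[C]_N) i : is_diag_mx A -> (A *m B) i i = A i i * B i i.
Proof.
move=> /is_diag_mxP hA; rewrite mxE (bigD1 i) //= big1 ?addr0 // => j ji.
by rewrite hA ?mul0r // eq_sym.
Qed.

Lemma cocharacter1 T c : mxsubgroup T -> cocharacter T c -> lpev c 1 = 1%:M.
Proof.
move=> [uT _ _ _] [Tc cM]; have u1 := uT _ (Tc 1 (oner_neq0 _)).
have := cM 1 1 (oner_neq0 _) (oner_neq0 _); rewrite mulr1 => /(congr1 (mulmx (invmx (lpev c 1)))).
by rewrite mulKmx // mulVmx.
Qed.

(** After conjugation by [P] the numerator is diagonal. Each diagonal entry is z ^ [lpden c] times a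
    multiplicative function, so it is a multiplicative polynomial with value 1 at 1, hence a power
    of z. *)
Lemma cocharacter_monomials T P c : mxsubgroup T -> P \in unitmx ->
  (forall A, T A -> is_diag_mx (P *m A *m invmx P)) -> cocharacter T c ->
  exists w : 'I_N -> nat,
    lpnum c = map_mx polyC (invmx P) *m diag_mx (\row_i 'X^(w i)) *m map_mx polyC P.
Proof.
move=> Tg uP Tdiag cc; have c1 := cocharacter1 Tg cc; case: cc => Tc cM.
pose D z := P *m lpev c z *m invmx P.
pose Q := map_mx polyC P *m lpnum c *m map_mx polyC (invmx P).
have QE z i j : z != 0 -> (Q i j).[z] = z ^+ lpden c * D z i j.
  move=> z0; transitivity (map_mx (horner_eval z) Q i j); first by rewrite [RHS]mxE.
  have evC (M : 'M[C]_N) : map_mx (horner_eval z) (map_mx polyC M) = M.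
    by apply/matrixP => i' j'; rewrite !mxE /horner_eval hornerC.
  have lE : map_mx (horner_eval z) (lpnum c) = z ^+ lpden c *: lpev c z.
    by rewrite /lpev scalerA divff ?expf_neq0 // scale1r.
  by rewrite !map_mxM !evC lE -scalemxAr -scalemxAl [LHS]mxE.
have Doff z i j : z != 0 -> i != j -> D z i j = 0.
  by move=> z0 ij; have /is_diag_mxP/(_ i j ij) := Tdiag _ (Tc z z0).
have DM z w i : z != 0 -> w != 0 -> D (z * w) i i = D z i i * D w i i.
  move=> z0 w0; have -> : D (z * w) = D z *m D w.
    by rewrite /D cM // !mulmxA mulmxKV //.
  exact: is_diag_mulmxE (Tdiag _ (Tc z z0)).
have D1 : D 1 = 1%:M by rewrite /D c1 mulmx1 mulmxV.
have hw i : exists w, Q i i = 'X^w.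
  apply: multiplicative_poly.
    apply/eqP => /(congr1 (fun q : {poly C} => q.[1])); rewrite QE ?oner_neq0 //.
    by rewrite D1 mxE eqxx horner0 expr1n mulr1 => /eqP; rewrite oner_eq0.
  by move=> z w z0 w0; rewrite !QE ?mulf_neq0 // DM // exprMn mulrACA.
have [w wE] := choice hw; exists w.
have uP' : map_mx polyC P *m map_mx polyC (invmx P) = 1%:M by rewrite -map_mxM mulmxV // map_mx1.
have uP'' : map_mx polyC (invmx P) *m map_mx polyC P = 1%:M by rewrite -map_mxM mulVmx // map_mx1.
suff <- : Q = diag_mx (\row_i 'X^(w i)).
  by rewrite /Q !mulmxA uP'' mul1mx -mulmxA uP'' mulmx1.
apply/matrixP => i j; rewrite [RHS]mxE [in RHS]mxE.
have [<-|ij] := eqVneq i j; first by rewrite wE mulr1n.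
by rewrite mulr0n; apply: poly_eq0_nonzero => z z0; rewrite QE // Doff // mulr0.
Qed.

(** The same integers [n] describe the cocharacter over every algebra and its derivative, which
    links weights of conjugation to eigenvalues of the bracket. *)
Lemma cocharacter_diag T P c : mxsubgroup T -> P \in unitmx ->
  (forall A, T A -> is_diag_mx (P *m A *m invmx P)) -> cocharacter T c ->
  exists n : 'I_N -> int,
    (forall (S : comUnitRingType) (f : {rmorphism C -> S}) (z : S), z \is a GRing.unit ->
       lpev_in f c z
       = map_mx f (invmx P) *m diag_mx (\row_i z ^ n i) *m map_mx f P) /\
    lpdiff c = invmx P *m diag_mx (\row_i (n i)%:~R) *m P.
Proof.
move=> Tg uP Tdiag cc; have [w wE] := cocharacter_monomials Tg uP Tdiag cc.
exists (fun i => (w i)%:Z - (lpden c)%:Z); split=> [S f z uz|].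
  rewrite /lpev_in wE; apply/matrixP => i j.
  rewrite !mxE /= /horner_eval rmorph_sum horner_sum mulr_sumr; apply: eq_bigr => k _.
  rewrite !mul_mx_diag !mxE !rmorphM /= !hornerM !map_polyC map_polyXn !hornerC hornerXn.
  by rewrite exprzDr // -exprnN mulrC mulrAC !mulrA.
apply/matrixP => i j; rewrite /lpdiff wE !mxE raddf_sum !horner_sum mulr_sumr -sumrB.
apply: eq_bigr => k _; rewrite !mul_mx_diag !mxE /= !(derivM, derivC, derivXn) !hornerE.
rewrite !expr1n hornerMn hornerXn expr1n rmorphB /=; ring.
Qed.

End LaurentCurves.

(** * The exponential e ^ (2 pi i r) and primitive roots of unity *)

Section RootsOfUnity.
Variable R : realType.
Implicit Types (r : R) (m : nat) (k : int).

Lemma e2piD r r' : e2pi (r + r') = e2pi r * e2pi r'.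
Proof.
rewrite /e2pi mulrDr cosD sinD; apply/eqP; rewrite eq_complex /=.
by rewrite eqxx addrC [X in _ + X]mulrC eqxx.
Qed.

Lemma e2pi0 : e2pi 0 = 1 :> R[i].
Proof. by rewrite /e2pi mulr0 cos0 sin0. Qed.

Lemma e2pi_neq0 r : e2pi r != 0.
Proof.
apply/eqP => r0; have := e2piD r (- r); rewrite subrr e2pi0 r0 mul0r.
by move/eqP; rewrite oner_eq0.
Qed.

Lemma e2piMn r m : e2pi (m%:R * r) = e2pi r ^+ m.
Proof.
elim: m => [|m ih]; first by rewrite mul0r e2pi0.
by rewrite -natr1 mulrDl mul1r e2piD ih exprSr.
Qed.

Lemma e2piMz r k : e2pi (k%:~R * r) = e2pi r ^ k.
Proof.
case: k => m; first exact: e2piMn.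
rewrite NegzE -exprnN -e2piMn rmorphN mulNr.
apply: (mulIf (e2pi_neq0 (m.+1%:R * r))); rewrite -e2piD addNr e2pi0 mulVf //.
exact: e2pi_neq0.
Qed.

Lemma e2pi_1 : e2pi 1 = 1 :> R[i].
Proof. by rewrite /e2pi mulr1 mulr_natl cos2pi sin2pi. Qed.

(** The real part gives cos(2 pi r) = 1, so sin(pi r) = 0, whereas the sine is positive strictly
    between 0 and pi. *)
Lemma e2pi_eq1 r : 0 <= r < 1 -> e2pi r = 1 -> r = 0.
Proof.
move=> /andP[r0 r1] /(congr1 (@complex.Re R)) /=.
have -> : 2 * pi * r = (pi * r) *+ 2 by rewrite -[RHS]mulr_natl mulrA.
rewrite cos_mulr2n cos2sin2; move/eqP; rewrite -subr_eq0.
have -> : (1 - sin (pi * r) ^+ 2) *+ 2 - 1 - 1 = - (sin (pi * r) ^+ 2 *+ 2) by ring.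
rewrite oppr_eq0 mulrn_eq0 /= sqrf_eq0 => /eqP s0.
apply/eqP; apply: contraT => rn0; have rp : 0 < r by rewrite lt_def rn0.
have : 0 < sin (pi * r).
  apply: sin_gt0_pi; rewrite mulr_gt0 ?pi_gt0 //= -[X in _ < X]mulr1.
  by rewrite ltr_pM2l ?pi_gt0.
by rewrite s0 ltxx.
Qed.

Lemma e2pi_div_eq1 m k : (0 < m)%N -> e2pi (m%:R^-1 : R) ^ k = 1 -> (m%:Z %| k)%Z.
Proof.
move=> m0; have mR : (m%:R : R) != 0 by rewrite pnatr_eq0 -lt0n.
rewrite {1}(divz_eq k m%:Z) exprzDr ?unitfE ?e2pi_neq0 // mulrC -exprz_exp exprzAC.
rewrite -[_ ^ m%:Z]e2piMz -[m%:~R]/(m%:R) divff // e2pi_1 exp1rz mulr1 -e2piMz.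
move=> /e2pi_eq1 h; apply/dvdz_mod0P/eqP; rewrite -(eqr_int R) -(inj_eq (mulIf (invr_neq0 mR))).
rewrite h ?mul0r // divr_ge0 ?ler0n ?ler0z ?modz_ge0 //=; last by lia.
by rewrite ltr_pdivrMr ?ltr0n // mul1r -[m%:R]/(m%:Z%:~R) ltr_int ltz_mod; lia.
Qed.

End RootsOfUnity.

(** * Weights read off matrix entries *)

Section Weights.
Variables (F : comUnitRingType) (N : nat) (P : 'M[F]_N).
Hypothesis uP : P \in unitmx.
Implicit Types (Y D : 'M[F]_N).

Local Notation conj Y := (P *m Y *m invmx P).

Lemma conj_inj Y Y' : conj Y = conj Y' -> Y = Y'.
Proof.
by move=> /(congr1 (fun Z => invmx P *m Z *m P)); rewrite !mulmxA mulVmx // !mul1mx !mulmxKV.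
Qed.

Lemma conj_diag (d : 'rV[F]_N) : conj (invmx P *m diag_mx d *m P) = diag_mx d.
Proof. by rewrite !mulmxA mulmxV // mul1mx mulmxK. Qed.

Lemma conjM Y Y' : conj (Y *m Y') = conj Y *m conj Y'.
Proof. by rewrite !mulmxA mulmxKV. Qed.

Lemma diag_eigen_conjP (d : 'rV[F]_N) (a : F) Y :
  let D := invmx P *m diag_mx d *m P in
  D *m Y = a *: (Y *m D) <-> forall i j, d 0 i * conj Y i j = a * (conj Y i j * d 0 j).
Proof.
move=> D; have cD : conj D = diag_mx d := conj_diag d; split=> [h i j|h].
  have := congr1 (fun Z => conj Z) h; rewrite -scalemxAr -scalemxAl (conjM D) (conjM Y) cD.
  by move: (conj Y) => Z /matrixP/(_ i j); rewrite mul_diag_mx mul_mx_diag !mxE.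
apply: conj_inj; rewrite -scalemxAr -scalemxAl (conjM D) (conjM Y) cD.
by move: (conj Y) h => Z h; apply/matrixP => i j; rewrite mul_diag_mx mul_mx_diag !mxE h.
Qed.

Lemma diag_bracket_conjP (d : 'rV[F]_N) (a : F) Y :
  let D := invmx P *m diag_mx d *m P in
  D *m Y - Y *m D = a *: Y <->
  forall i j, d 0 i * conj Y i j - conj Y i j * d 0 j = a * conj Y i j.
Proof.
have cB Z Z' : conj (Z - Z') = conj Z - conj Z' by rewrite mulmxBr mulmxBl.
move=> D; have cD : conj D = diag_mx d := conj_diag d; split=> [h i j|h].
  have := congr1 (fun Z => conj Z) h; rewrite -scalemxAr -scalemxAl cB (conjM D) (conjM Y) cD.
  by move: (conj Y) => Z /matrixP/(_ i j); rewrite mul_diag_mx mul_mx_diag !mxE.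
apply: conj_inj; rewrite -scalemxAr -scalemxAl cB (conjM D) (conjM Y) cD.
by move: (conj Y) h => Z h; apply/matrixP => i j; rewrite mul_diag_mx mul_mx_diag !mxE h.
Qed.

End Weights.

(* Y has weight k for conjugation by diag(z ^ n_i) in the basis given by P. *)
Definition pure_weight (F : fieldType) (N : nat) (P : 'M[F]_N) (n : 'I_N -> int) (k : int)
    (Y : 'M[F]_N) :=
  forall i j, (P *m Y *m invmx P) i j != 0 -> n i - n j = k.

(** The element 2 has infinite multiplicative order, so the single test value z = 2 recovers a
    weight from the torus action. *)
Lemma exprz2_inj (F : numFieldType) : injective (fun k : int => (2 : F) ^ k).
Proof.
have t0 : (2 : F) != 0 by rewrite pnatr_eq0.
have pow1 (c : nat) : (2 : F) ^+ c = 1 -> c = 0%N.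
  by move/eqP; rewrite -natrX (eqr_nat F _ 1); case: c => // c; rewrite expnS; lia.
move=> a b /= e; suff : a - b = 0 by lia.
have : (2 : F) ^ (a - b) = 1 by rewrite expfzDr // e -expfzDr // subrr.
case: (a - b) => c; first by move/pow1 ->.
by move/eqP; rewrite NegzE -exprnN invr_eq1 => /eqP/pow1.
Qed.

Section PureWeight.
Variables (F : numFieldType) (N : nat) (P : 'M[F]_N) (n : 'I_N -> int).
Hypothesis uP : P \in unitmx.
Implicit Types (Y : 'M[F]_N) (k : int).

Local Notation dg z := (invmx P *m diag_mx (\row_i z ^ n i) *m P).
Local Notation hn := (invmx P *m diag_mx (\row_i (n i)%:~R) *m P).

Lemma pure_weight_torus k Y :
  (forall z, z != 0 -> dg z *m Y = z ^ k *: (Y *m dg z)) -> pure_weight P n k Y.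
Proof.
have t0 : (2 : F) != 0 by rewrite pnatr_eq0.
move=> /(_ _ t0)/(diag_eigen_conjP uP) h i j Yij.
move: (h i j) Yij; move: (_ i j) => y; rewrite !mxE => e y0.
have {}e := mulIf y0 (etrans e (etrans (mulrCA _ _ _) (mulrC _ _))).
suff : n i = k + n j by lia.
by apply: (@exprz2_inj F); rewrite /= expfzDr.
Qed.

(** The infinitesimal form of a weight, which an automorphism of the Lie algebra can transport. *)
Lemma pure_weight_bracketP k Y :
  hn *m Y - Y *m hn = k%:~R *: Y <-> pure_weight P n k Y.
Proof.
split=> [/(diag_bracket_conjP uP) h i j Yij|h].
  move: (h i j) Yij; move: (_ i j) => y; rewrite !mxE [X in _ - X]mulrC -mulrBl => e y0.
  by have := mulIf y0 e; rewrite -rmorphB => /intr_inj.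
apply/(diag_bracket_conjP uP) => i j; move: (h i j); move: (_ i j) => y {}h.
rewrite !mxE [X in _ - X]mulrC -mulrBl -rmorphB.
by have [->|/h ->] := eqVneq y 0; rewrite ?mulr0.
Qed.

End PureWeight.

(** Needed at two points: at xi_m over the complex numbers, for exp(x), and at u ^ -e over the
    Laurent series, for the gauge. *)
Lemma pure_weight_action (F : fieldType) (S : comUnitRingType) (f : {rmorphism F -> S})
    (N : nat) (P Y : 'M[F]_N) (n : 'I_N -> int) k (z : S) :
  P \in unitmx -> pure_weight P n k Y -> z \is a GRing.unit ->
  let D := map_mx f (invmx P) *m diag_mx (\row_i z ^ n i) *m map_mx f P in
  D *m map_mx f Y = z ^ k *: (map_mx f Y *m D).
Proof.
move=> uP h uz; rewrite map_invmx; apply/diag_eigen_conjP; first by rewrite map_unitmx.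
move=> i j; rewrite -map_invmx -!map_mxM [map_mx f (_ *m _) _ _]mxE.
move: (h i j); move: (_ i j) => y {}h; rewrite !mxE.
have [->|/h <-] := eqVneq y 0; first by rewrite rmorph0 mul0r !mulr0.
by rewrite mulrCA mulrC -exprzDr // subrK.
Qed.

Section LinearForms.
Import (canonicals) mpoly.
Variables (R : realType) (N : nat).
Local Notation C := R[i].
Implicit Types (L A Y : 'M[C]_N).

Lemma big_mxvec_index (F : 'I_(N * N) -> C) :
  \sum_k F k = \sum_i \sum_j F (mxvec_index i j).
Proof.
by rewrite pair_bigA (reindex _ (curry_mxvec_bij N N)); apply: eq_bigr => -[].
Qed.

Definition linear_mpoly L : mpoly.mpoly (N * N) C :=
  \sum_k mxvec L 0 k *: mpoly.mpolyX C (mpoly.mnm1 k).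

Lemma pev_linear_mpoly L A : pev (linear_mpoly L) A = \sum_i \sum_j L i j * A i j.
Proof.
rewrite /pev /linear_mpoly (raddf_sum (mpoly.meval _)) big_mxvec_index /=.
apply: eq_bigr => i _; apply: eq_bigr => j _.
by rewrite mpoly.mevalZ mpoly.mevalXU !mxvecE.
Qed.

Lemma pdiff_linear_mpoly L Y : pdiff (linear_mpoly L) Y = pev (linear_mpoly L) Y.
Proof.
rewrite pev_linear_mpoly; apply: eq_bigr => i _; apply: eq_bigr => j _.
rewrite mulrC; congr (_ * _); set k := mxvec_index i j.
rewrite /pev /linear_mpoly (raddf_sum (mpoly.mderiv k)) (raddf_sum (mpoly.meval _)) /=.
rewrite (bigD1 k) //= big1 => [|k' kk'].
  rewrite mpoly.mderivZ mpoly.mevalZ mpoly.mderivX mpoly.mevalZ mpoly.mevalX mpoly.mnm1E eqxx.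
  rewrite mxvecE big1 ?addr0 ?mul1r ?mulr1 // => k' _.
  by rewrite mpoly.mnmBE subnn.
rewrite mpoly.mderivZ mpoly.mevalZ mpoly.mderivX mpoly.mevalZ mpoly.mnm1E (negPf kk').
by rewrite mul0r mulr0.
Qed.

Lemma Lie_scale G a Y : @Lie R N G Y -> Lie G (a *: Y).
Proof.
move=> hY p pG; rewrite -[RHS](mulr0 a) -(hY p pG) /pdiff mulr_sumr.
apply: eq_bigr => i _; rewrite mulr_sumr; apply: eq_bigr => j _.
by rewrite mxE mulrA.
Qed.

Lemma Lie0 G : @Lie R N G 0.
Proof.
move=> p _; rewrite /pdiff big1 // => i _; rewrite big1 // => j _.
by rewrite mxE mul0r.
Qed.

End LinearForms.

(** * The exponential of x as a value of the cocharacter *)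

Section Exponential.
Variables (R : realType) (N : nat).
Local Notation C := R[i].
Implicit Types (G T : set 'M[C]_N) (P x Y : 'M[C]_N) (c : lpolymx R N).

(* The diagonal coordinates of a diagonalized torus are characters, and they
   separate its points. *)
Lemma exp_cocharacter T P c x expx (m : nat) : (0 < m)%N -> mxsubgroup T ->
  P \in unitmx -> (forall A, T A -> is_diag_mx (P *m A *m invmx P)) ->
  cocharacter T c -> lpdiff c = m%:R *: x -> is_exp T x expx ->
  expx = lpev c (e2pi m%:R^-1).
Proof.
move=> m0 Tg uP Tdiag cc cx [Tx hx].
have [n [cE dE]] := cocharacter_diag Tg uP Tdiag cc.
set z := e2pi _; have z0 : z != 0 := e2pi_neq0 _.
pose L i := \matrix_(j, k) (P i j * invmx P k i).
have LE i A : pev (linear_mpoly (L i)) A = (P *m A *m invmx P) i i.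
  rewrite pev_linear_mpoly exchange_big /= mxE; apply: eq_bigr => k _.
  rewrite mxE mulr_suml; apply: eq_bigr => j _; rewrite mxE; ring.
pose f i := Regfun (linear_mpoly (L i)) 0.
have fE i A : rfev (f i) A = (P *m A *m invmx P) i i.
  by rewrite /rfev /= expr0 divr1.
have dfE i Y : rdiff (f i) Y = (P *m Y *m invmx P) i i.
  by rewrite /rdiff /= pdiff_linear_mpoly LE mul0r mul0r subr0.
have fT i : character T (f i).
  split; first by rewrite fE mulmx1 mulmxV // mxE eqxx.
  move=> A A' TA TA'; rewrite !fE conjM //; exact: is_diag_mulmxE (Tdiag _ TA).
have cz : T (lpev c z) := cc.1 _ z0.
apply: (conj_inj uP); apply/matrixP => i j.
have [<-|ij] := eqVneq i j; last first.
  have /is_diag_mxP -> // := Tdiag _ Tx; have /is_diag_mxP -> // := Tdiag _ cz.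
have mC : (m%:R : C) != 0 by rewrite pnatr_eq0 -lt0n.
(* The pairing of the i-th coordinate character with [x] is the real number n_i / m, so taking
   [complex.Re] in [is_exp] loses nothing. *)
have xii : (P *m x *m invmx P) i i = ((n i)%:~R * m%:R^-1 : R)%:C%C.
  have -> : x = m%:R^-1 *: lpdiff c by rewrite cx scalerA mulVf // scale1r.
  rewrite -(scalemxAr _ P) -scalemxAl dE conj_diag // !mxE eqxx mulr1n.
  by rewrite rmorphM fmorphV /= rmorph_nat rmorph_int mulrC.
rewrite -fE (hx _ (fT i)) dfE xii /= e2piMz -lpev_in_id (cE _ idfun) ?unitfE //.
by rewrite !map_mx_id // conj_diag // [RHS]mxE [in RHS]mxE eqxx.
Qed.

End Exponential.

Section LieAutomorphism.
Variables (R : realType) (N : nat) (G : set 'M[R[i]]_N) (sigma : 'M[R[i]]_N -> 'M[R[i]]_N).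
Hypothesis hsigma : lie_automorphism G sigma.
Implicit Types (x Y : 'M[R[i]]_N).

Lemma lie_automorphism0 : sigma 0 = 0.
Proof.
have [_ slin _] := hsigma; have := slin 1 0 0 (@Lie0 R N G) (@Lie0 R N G).
by rewrite !scale1r addr0 => /eqP; rewrite -[X in X == _]addr0 (inj_eq (addrI _)) eq_sym => /eqP.
Qed.

Lemma lie_automorphismZ a Y : Lie G Y -> sigma (a *: Y) = a *: sigma Y.
Proof.
have [_ slin _] := hsigma => GY; have := slin a Y 0 GY (@Lie0 R N G).
by rewrite lie_automorphism0 !addr0.
Qed.

Lemma iter_lie_automorphism_eigen a Y j : Lie G Y -> sigma Y = a *: Y ->
  iter j sigma Y = a ^+ j *: Y.
Proof.
move=> GY sY; elim: j => [|j ih] /=; first by rewrite expr0 scale1r.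
by rewrite ih lie_automorphismZ // sY scalerA -exprSr.
Qed.

Lemma lie_automorphism_bracket_eigen a x Y : Lie G x -> sigma x = x -> Lie G Y ->
  bracket x Y = a *: Y -> bracket x (sigma Y) = a *: sigma Y.
Proof.
move=> Gx sx GY h; have [_ _ sb] := hsigma.
by rewrite -{1}sx -sb // h lie_automorphismZ.
Qed.

End LieAutomorphism.

Lemma diagonalizable_nilpotent (R : realType) (N : nat) (X : 'M[R[i]]_N) a :
  a != 0 -> diagonalizable X -> nilpotent_mx (a *: X) -> X = 0.
Proof.
move=> a0 [P uP /diagonalizable_forPex[d /(simmxP uP) PX]] [n hn].
have Pn k : P *m (a *: X) ^+ k = diag_mx (\row_i (a * d 0 i) ^+ k) *m P.
  elim: k => [|k ih].
    have -> : \row_i (a * d 0 i) ^+ 0 = const_mx 1 by apply/rowP => i; rewrite !mxE expr0.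
    by rewrite diag_const_mx mul1mx expr0 mulmx1.
  rewrite exprS -mulmxE mulmxA -scalemxAr PX scalemxAl -mulmxA ih mulmxA.
  congr (_ *m _); apply/matrixP => i j; rewrite mul_mx_diag !mxE exprS.
  by case: eqP => [->|_]; rewrite ?mulr1n // !mulr0n mulr0 mul0r.
have d0 : d = 0.
  have := Pn n; rewrite hn mulmx0 => /(congr1 (mulmxr (invmx P))) /=.
  rewrite mul0mx mulmxK // => h; apply/rowP => i; have /matrixP/(_ i i)/esym/eqP := h.
  by rewrite !mxE eqxx mulr1n expf_eq0 mulf_eq0 (negPf a0) /= => /andP[_ /eqP].
by rewrite -(mulKmx uP X) PX d0 linear0 mul0mx mulmx0.
Qed.

Section Conjugation.
Variables (S : comUnitRingType) (N : nat).
Implicit Types (A B D g : 'M[S]_N).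

Lemma mulmx_sandwich A B D D' : B *m A = 1%:M ->
  (A *m D *m B) *m (A *m D' *m B) = A *m (D *m D') *m B.
Proof. by move=> BA; rewrite -!mulmxA; congr (A *m (D *m _)); rewrite (mulmxA B A) BA mul1mx. Qed.

Lemma sandwich_scale A B D D' D'' (s : S) : B *m A = 1%:M -> D'' = s *: (D *m D') ->
  A *m D'' *m B = s *: ((A *m D *m B) *m (A *m D' *m B)).
Proof. by move=> BA ->; rewrite mulmx_sandwich // -scalemxAr -scalemxAl. Qed.

Lemma conj_sum_eigen g (I : eqType) (r : seq I) (Y : I -> 'M[S]_N) (c : S) (t w : I -> S) :
  g \in unitmx -> (forall i, i \in r -> g *m Y i = w i *: (Y i *m g)) ->
  g *m (c *: \sum_(i <- r) t i *: Y i) *m invmx g = c *: \sum_(i <- r) (t i * w i) *: Y i.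
Proof.
move=> ug h; rewrite -scalemxAr -scalemxAl mulmx_sumr mulmx_suml; congr (_ *: _).
by apply: eq_big_seq => i /h hi; rewrite -scalemxAr hi scalerA -scalemxAl mulmxK.
Qed.

End Conjugation.

(** * The theta-connection at infinity in the gauge given by lambda *)

Section ThetaGauge.
Variables (R : realType) (N : nat).
Local Notation C := R[i].
Local Notation K := (laurent C).
Local Notation cst M := (map_mx (@lconst C) M).
Implicit Types (M X P : 'M[C]_N) (p q k : int) (a b : C).

Lemma lmonomialM a b p q :
  (lconst a * lmono C p) * (lconst b * lmono C q) = lconst (a * b) * lmono C (p + q).
Proof. by rewrite mulrACA -lmonoD rmorphM. Qed.

Lemma mxlcoef_monomialZ a q k M :
  mxlcoef k ((lconst a * lmono C q) *: cst M) = if k == q then a *: M else 0.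
Proof.
apply/matrixP => i j; rewrite !mxE -mulrA lcoef_constM lcoef_monoM /= subr_eq0.
by case: eqP => _; rewrite mxE ?mulr0.
Qed.

(** For t = u ^ -m one has dt / t = - m du / u, the source of the constant [- m], and t ^ (e (1 - k)
    / m) = u ^ (e (k - 1)). *)
Lemma ramify_theta_connection (e m : nat) ks (X_ : int -> 'M[C]_N) : (0 < m)%N ->
  (forall k, k \in ks -> X_ k != 0 -> (m%:Z %| e%:Z * (1 - k))%Z) ->
  ramify m (theta_connection e m ks X_ (t_at_infinity R)) =
  (lconst (- m%:R) * lmono C (- 1)) *:
    \sum_(k <- ks) lmono C (e%:Z * (k - 1)) *: cst (X_ k).
Proof.
move=> m0 dvd; rewrite /ramify /theta_connection /t_at_infinity lmonoV map_mxZ scalerA.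
have -> : lderiv (lmono C m%:Z) * lsubst m (lderiv (lmono C (- 1)) / lmono C (- 1))
    = lconst (- m%:R) * lmono C (- 1).
  have -> : lderiv (lmono C (- 1)) / lmono C (- 1) = lconst (-1)%:~R * lmono C (- 1).
    by rewrite lderiv_mono lmonoV -mulrA lmonoD.
  rewrite lderiv_mono rmorphM /= lsubst_const // lsubst_mono //.
  rewrite lmonomialM (_ : m%:Z%:~R * (-1)%:~R = - m%:R); last by rewrite rmorphN mulrN mulr1.
  by rewrite (_ : m%:Z - 1 + m%:Z * -1 = -1) //; lia.
apply: (congr1 (GRing.scale _)); rewrite raddf_sum.
apply: eq_big_seq => k kks /=; rewrite map_mxZ -map_mx_comp.
have -> : map_mx (lsubst m \o @lconst C) (X_ k) = cst (X_ k).
  by apply: eq_map_mx => c; exact: lsubst_const.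
(* When [X_ k = 0] the integer quotient in the exponent may be rounded, but the term vanishes
   anyway. *)
have [->|Xk] := eqVneq (X_ k) 0; first by rewrite !map_mx0 !scaler0.
have /dvdzP[q qE] := dvd _ kks Xk.
rewrite lmonoXz /= lsubst_mono // qE mulzK; last by lia.
by rewrite (_ : m%:Z * (-1 * q) = e%:Z * (k - 1)) //; rewrite -[k - 1]opprB mulrN qE; ring.
Qed.

Section Weights.
Variables (P : 'M[C]_N) (n : 'I_N -> int) (e : nat).
Hypothesis uP : P \in unitmx.
Local Notation D := (diag_mx (\row_i lmono C (- e%:Z) ^ n i)).
Local Notation g := (cst (invmx P) *m D *m cst P).

Lemma cst_conj : cst P *m cst (invmx P) = 1%:M.
Proof. by rewrite -map_mxM mulmxV // map_mx1. Qed.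

Lemma torus_Kpoint_unit : g \in unitmx.
Proof.
suff gg' : g *m (cst (invmx P) *m diag_mx (\row_i lmono C e%:Z ^ n i) *m cst P) = 1%:M.
  exact (proj1 (mulmx1_unit gg')).
rewrite (mulmx_sandwich _ _ cst_conj) mulmx_diag.
have -> : \row_i ((\row_i lmono C (- e%:Z) ^ n i) 0 i * (\row_i lmono C e%:Z ^ n i) 0 i)
    = const_mx 1 :> 'rV[K]_N.
  by apply/rowP => i; rewrite !mxE !lmonoXz lmonoD mulNr addNr lmono0.
by rewrite diag_const_mx mulmx1 -map_mxM mulVmx // map_mx1.
Qed.

Lemma map_lderiv_cst M : map_mx (@lderiv C) (cst M) = 0.
Proof. by apply/matrixP => i j; rewrite !mxE lderiv_const. Qed.

(** Each diagonal entry u ^ (- e n_i) is multiplied by - e n_i / u. This is the origin of the term e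
    d(lambda) / u in the gauged connection. *)
Lemma torus_Kpoint_lderiv :
  map_mx (@lderiv C) g = (lconst (- e%:R) * lmono C (- 1)) *:
    (cst (invmx P *m diag_mx (\row_i (n i)%:~R) *m P) *m g).
Proof.
rewrite !map_lderivM !map_lderiv_cst mul0mx add0r mulmx0 addr0 !map_mxM.
apply: sandwich_scale cst_conj _.
rewrite map_diag_mx mulmx_diag; apply/matrixP => i j; rewrite !mxE raddfMn mulrnAr.
congr (_ *+ _); rewrite lmonoXz /= lderiv_mono lmonomialM addrC.
by rewrite (_ : (- e%:Z * n i)%:~R = - e%:R * (n i)%:~R) // rmorphM rmorphN.
Qed.

Lemma gauge_weights ks (X_ : int -> 'M[C]_N) a :
  (forall k, k \in ks -> pure_weight P n k (X_ k)) ->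
  gauge g ((lconst a * lmono C (- 1)) *:
             \sum_(k <- ks) lmono C (e%:Z * (k - 1)) *: cst (X_ k)) =
  (lconst a * lmono C (- e.+1%:Z)) *: cst (\sum_(k <- ks) X_ k) +
  (lconst e%:R * lmono C (- 1)) *: cst (invmx P *m diag_mx (\row_i (n i)%:~R) *m P).
Proof.
move=> hX; have ug := torus_Kpoint_unit; rewrite /gauge torus_Kpoint_lderiv.
rewrite -[in X in _ - X]scalemxAl (mulmxK ug) -scaleNr; congr (_ + _ *: _); last first.
  by rewrite -mulNr -rmorphN opprK.
rewrite (conj_sum_eigen (w := fun k => lmono C (- e%:Z) ^ k) _ _ ug); last first.
  by move=> k /hX hk; apply: pure_weight_action; rewrite ?lmono_unit.
rewrite [in RHS](raddf_sum (map_mx (@lconst C))) /=.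
have -> : \sum_(k <- ks) (lmono C (e%:Z * (k - 1)) * lmono C (- e%:Z) ^ k) *: cst (X_ k)
    = lmono C (- e%:Z) *: \sum_(k <- ks) cst (X_ k).
  rewrite [RHS]scaler_sumr; apply: eq_bigr => k _; rewrite lmonoXz lmonoD.
  by rewrite (_ : e%:Z * (k - 1) + - e%:Z * k = - e%:Z) //; ring.
by rewrite scalerA -mulrA lmonoD (_ : - 1 + - e%:Z = - e.+1%:Z) //; lia.
Qed.

End Weights.
End ThetaGauge.

(* If X has weight k then so does sigma X, because sigma fixes x; hence
   theta X = xi X reads sigma X = xi ^ (1 - k) X, and sigma ^ e = 1. *)
Lemma weight_dvd (R : realType) (N : nat) (G T : set 'M[R[i]]_N)
    (sigma theta : 'M[R[i]]_N -> 'M[R[i]]_N) (e m : nat) (x expx P : 'M[R[i]]_N)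
    (lam : lpolymx R N) (X : 'M[R[i]]_N) (k : int) :
  lie_automorphism G sigma -> (forall Y, Lie G Y -> iter e sigma Y = Y) -> (0 < m)%N ->
  mxsubgroup T -> (T `<=` G)%classic -> P \in unitmx ->
  (forall A, T A -> is_diag_mx (P *m A *m invmx P)) -> cocharacter T lam ->
  lpdiff lam = m%:R *: x -> sigma x = x -> is_exp T x expx ->
  (forall Y, Lie G Y -> theta Y = expx *m sigma Y *m invmx expx) ->
  g_wt G theta m lam 1 k X -> X != 0 -> (m%:Z %| e%:Z * (1 - k))%Z.
Proof.
move=> hs he m0 Tg TG uP Tdiag clam lamx sx hexp htheta [[GX thX] lamX] X0.
have [n [lamE dlamE]] := cocharacter_diag Tg uP Tdiag clam.
have lamT z : z != 0 -> T (lpev lam z) by case: clam => h _; exact: h.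
have lamu z : z != 0 -> lpev lam z \in unitmx by move=> /lamT; case: Tg => h _ _ _; exact: h.
have lamD z : z != 0 -> lpev lam z = invmx P *m diag_mx (\row_i z ^ n i) *m P.
  by move=> z0; rewrite -lpev_in_id lamE ?unitfE // !map_mx_id.
have mC : (m%:R : R[i]) != 0 by rewrite pnatr_eq0 -lt0n.
have xE : x = m%:R^-1 *: lpdiff lam by rewrite lamx scalerA mulVf // scale1r.
have Gx : Lie G x.
  rewrite xE; apply: Lie_scale; apply: lpdiff_Lie (cocharacter1 Tg clam) => z z0.
  exact: TG (lamT z z0).
have bracket_x a Y : bracket x Y = (m%:R^-1 * a) *: Y <->
    lpdiff lam *m Y - Y *m lpdiff lam = a *: Y.
  rewrite lamx /bracket -scalemxAl -scalemxAr -scalerBr.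
  split=> [->|h]; first by rewrite scalerA mulrA divff // mul1r.
  by rewrite -scalerA -h scalerA mulVf // scale1r.
have wX : pure_weight P n k X.
  apply: (pure_weight_torus uP) => z z0; rewrite -lamD // scalemxAl -lamX //.
  by rewrite mulmxKV // lamu.
(* The bracket with [x] is 1 / m times that with d(lambda); it is in this form that [sigma], which
   fixes [x], preserves the weight. *)
have wsX : pure_weight P n k (sigma X).
  apply/(pure_weight_bracketP _ uP); rewrite -dlamE -bracket_x.
  apply: (lie_automorphism_bracket_eigen hs Gx sx GX); apply/bracket_x.
  by rewrite dlamE; apply/(pure_weight_bracketP _ uP).
pose xi : R[i] := e2pi m%:R^-1; have xi0 : xi != 0 := e2pi_neq0 _.
have sX : sigma X = xi ^ (1 - k) *: X.
  have := htheta X GX; rewrite thX (exp_cocharacter m0 Tg uP Tdiag clam lamx hexp) -/xi expr1.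
  have := @pure_weight_action _ _ idfun _ _ _ _ _ xi uP wsX.
  rewrite unitfE !map_mx_id // -lamD // => -> //; rewrite -scalemxAl mulmxK ?lamu //.
  move=> /(congr1 (GRing.scale (xi ^ (- k)))); rewrite !scalerA -expfzDr // addNr scale1r => <-.
  by rewrite -{2}[xi]expr1z -expfzDr // addrC.
(* Because xi is a primitive [m]-th root of unity, it suffices that xi ^ (e (1 - k)) = 1, the
   eigenvalue of sigma ^ e on the nonzero [X]. *)
apply: (e2pi_div_eq1 m0 (R := R)); rewrite -/xi mulrC -exprz_exp -[_ ^ e%:Z]/(_ ^+ e).
have := iter_lie_automorphism_eigen hs e GX sX; rewrite he // => /eqP.
by rewrite -{1}[X]scale1r -subr_eq0 -scalerBl scaler_eq0 (negPf X0) orbF subr_eq0 => /eqP.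
Qed.

Theorem mainTheorem4
  (R : realType) (N : nat)
  (* the group, a Borel pair and a pinning *)
  (G T B : set 'M[R[i]]_N)
  (hG : simple_group G) (hGad : adjoint_type G)
  (hT : maximal_torus T G) (hB : borel B G) (hTB : (T `<=` B)%classic)
  (l : nat) (alpha : 'I_l -> regfun R N) (halpha : simple_roots alpha B T)
  (E : 'I_l -> 'M[R[i]]_N) (hE : pinning alpha G T E)
  (* the pinned automorphism sigma, of order e *)
  (s : {perm 'I_l}) (sigma : 'M[R[i]]_N -> 'M[R[i]]_N) (e : nat)
  (hsigma : pinned_automorphism alpha G T E s sigma)
  (he : order_on (Lie G) sigma e)
  (* theta = Ad(exp x) o sigma, of order m, with x in the closed alcove *)
  (eta : 'M[R[i]]_N -> R[i]) (heta : is_eta alpha G T sigma e eta)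
  (x expx : 'M[R[i]]_N)
  (hx : in_alcove alpha T sigma e eta x) (hexpx : is_exp T x expx)
  (theta : 'M[R[i]]_N -> 'M[R[i]]_N)
  (htheta : forall Y, Lie G Y -> theta Y = expx *m sigma Y *m invmx expx)
  (m : nat) (hm : order_on (Lie G) theta m)
  (* the cocharacter lambda = m x *)
  (lam : lpolymx R N) (hlam : cocharacter T lam) (hlamx : lpdiff lam = m%:R *: x)
  (* X in g_1 and its components X_k in g_1(k) *)
  (X : 'M[R[i]]_N) (hX : g_ G theta m 1 X) (hX0 : X != 0) (hXss : diagonalizable X)
  (ks : seq int) (X_ : int -> 'M[R[i]]_N)
  (hks : uniq ks) (hX_ : forall k, k \in ks -> g_wt G theta m lam 1 k (X_ k))
  (hXsum : X = \sum_(k <- ks) X_ k) :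
  let nabla := theta_connection e m ks X_ (t_at_infinity R) in
  irregular G nabla /\ has_slope G nabla e m.
Proof.
move=> nabla.
have [[[Tg _] _ [P uP Tdiag]] TG _] := hT.
have [_ hs _ _] := hsigma.
have [e0 he1 _] := he; have [m0 _ _] := hm.
have [[_ sx] _ _] := hx.
have [n [lamE dlamE]] := cocharacter_diag Tg uP Tdiag hlam.
suff slope : has_slope G nabla e m by split=> //; exact: slope_irregular slope.
split=> //; pose z := lmono R[i] (- e%:Z).
have uz : z \is a GRing.unit by exact: lmono_unit.
have gE := lamE _ (@lconst R[i]) z uz.
have wX k : k \in ks -> pure_weight P n k (X_ k).
  move=> /hX_[_ lamX]; apply: (pure_weight_torus uP) => w w0.
  have := lamE _ idfun w; rewrite unitfE !map_mx_id // lpev_in_id => /(_ w0) <-.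
  rewrite scalemxAl -lamX // mulmxKV //.
  by case: Tg => h _ _ _; apply: h; case: hlam => h' _; exact: h'.
(* The gauge is [lam] evaluated at the Laurent series z = u ^ -e. *)
exists (lpev_in (@lconst R[i]) lam z).
  split; first by rewrite gE; exact: torus_Kpoint_unit.
  move=> p pG; apply: lpev_in_vanishing pG => // w w0.
  by apply: TG; case: hlam => h' _; exact: h'.
have -> : gauge (lpev_in (@lconst R[i]) lam z) (ramify m nabla) =
    (lconst (- m%:R) * lmono R[i] (- e.+1%:Z)) *: map_mx (@lconst R[i]) X +
    (lconst e%:R * lmono R[i] (- 1)) *: map_mx (@lconst R[i]) (lpdiff lam).
  rewrite gE dlamE hXsum -(gauge_weights e uP _ wX) /nabla ramify_theta_connection //.
  move=> k kks; exact: weight_dvd hs he1 m0 Tg TG uP Tdiag hlam hlamx sx hexpx htheta (hX_ _ kks).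
split=> [k hk|].
  rewrite mxlcoefD !mxlcoef_monomialZ lt_eqF // ifF ?addr0 //.
  by apply/negbTE; rewrite lt_eqF //; lia.
(* As [e > 0], the simple pole e d(lambda) / u does not reach degree - (e + 1), where - m X alone
   remains. *)
rewrite mxlcoefD !mxlcoef_monomialZ eqxx ifF ?addr0; last by apply/negbTE/eqP; lia.
move=> /(diagonalizable_nilpotent _ hXss) X0; case/eqP: hX0; apply: X0.
by rewrite oppr_eq0 pnatr_eq0 -lt0n.
Qed.
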